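(* Let $\mathcal M_3$ be the space of triples $\underline\varphi=(\varphi_1,\varphi_2,\varphi_3)$ of closed $G_2$-structures $\varphi_i=\varphi^K-(u_i-1)d\theta^i\wedge dx^{0i}$ (no summation) on $\mathbb T^7$, with metric $\underline{\mathcal G}=\sum_i\int_{S^1}u_i^{-1}Q_i(g_i)Q_i(h_i)$. Let $\chi_1,\chi_2,\chi_3$ be smooth non-negative concave functions on $(0,\infty)$ and $\mathrm{Vol}_{\underline\chi}(\underline\varphi)=\sum_i\int_{S^1}\chi_i(u_i)$. Then: (1) the connection $D_XY=Y_t+\sum_iU_i'\,d\theta^i\wedge dx^{0i}$, with $$U_i=\frac{f_iQ_i(g_i)+g_iQ_i(f_i)}{u_i}-\frac{Q_i(f_i)Q_i(g_i)u_i'}{u_i^2},$$ where $X=-(f_i\,d\theta^i\wedge dx^{0i})_i$ and $Y=-(g_i\,d\theta^i\wedge dx^{0i})_i$, is the Levi-Civita connection of $\underline{\mathcal G}$ on $\mathcal M_3$; (2) $\mathrm{Vol}_{\underline\chi}$ is geodesically concave: along any geodesic $\underline\varphi(t)$ (with $f_i=(u_i)_t$), $$\partial_t^2\mathrm{Vol}_{\underline\chi}=\sum_i\int_{S^1}\chi_i''(u_i)K_i^2,\qquad K_i=f_i-\frac{u_i'Q_i(f_i)}{u_i};$$ (3) the $\underline\chi$ flow $(u_i)_t=-(\chi_i''(u_i)u_i'u_i)'$, $i=1,2,3$, decreases the distance: for every smooth family $\underline u(t,s)$, $s\in[0,1]$, of solutions of the flow, $\underline{\mathcal G}(\partial_s\underline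 u,\partial_s\underline u)$ is non-increasing in $t$, and hence so is the $\underline{\mathcal G}$-length of $s\mapsto\underline u(t,s)$; (4) the sectional curvature of $(\mathcal M_3,\underline{\mathcal G})$ is non-negative.
   Context: Let $S^1=\mathbb R/\mathbb Z$ (unit length) with coordinate $x=x_0$, and $\mathbb T^7=\mathbb T^3\times\mathbb T^4$ with coordinates $\theta^1,\theta^2,\theta^3,x^0,\dots,x^3$. $\varphi^K=d\theta^{123}-\sum_id\theta^i\wedge\omega^K_i$ with $\omega_1^K=dx^{01}+dx^{23}$, $\omega_2^K=dx^{02}+dx^{31}$, $\omega_3^K=dx^{03}+dx^{12}$. Each $u_i=u_i(x_0)>0$ is smooth with $\int_{S^1}u_i=1$. Tangent vectors are triples $-(f_i\,d\theta^i\wedge dx^{0i})_{i=1,2,3}$ with $f_i\in C_0^\infty(S^1)$ (smooth, zero mean); prime is $\partial_{x_0}$ for functions on $S^1$, while $\chi_i''$ is the second derivative of $\chi_i$. For $g\in C_0^\infty(S^1)$ with $G(x)=\int_0^xg$, $Q_i(g)=G-\big[\int_{S^1}u_i^{-1}G\big]\big[\int_{S^1}u_i^{-1}\big]^{-1}$. In the expression $Y_t+\sum_iU_i'd\theta^i\wedge dx^{0i}$, the $i$-th summand is the $i$-th component of the triple. The geodesic equation is $(u_i)_t=f_i$, $(f_i)_t=\tilde U_i'$, $\tilde U_i=\frac{2f_iQ_i(f_i)}{u_i}-\frac{Q_i(f_i)^2u_i'}{u_i^2}$. *)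

(* Defs.v *)
From Stdlib Require Import Reals Arith.
From Coquelicot Require Import Coquelicot.
Open Scope R_scope.

(** A point of R^n is a sequence of which only the entries [0 .. n-1] matter.
    [cont_at n F p] quantifies over all [q] whose first [n] entries are close to
    those of [p], so it forces [F] not to depend on the other entries. *)

Definition vec := nat -> R.

Definition near_n (n : nat) (d : R) (p q : vec) : Prop :=
  forall k, (k < n)%nat -> Rabs (q k - p k) < d.

Definition open_n (n : nat) (O : vec -> Prop) : Prop :=
  forall p, O p -> exists d, 0 < d /\ forall q, near_n n d p q -> O q.

Definition cont_at (n : nat) (F : vec -> R) (p : vec) : Prop :=
  forall eps, 0 < eps ->
  exists d, 0 < d /\ forall q, near_n n d p q -> Rabs (F q - F p) < eps.

Definition upd (p : vec) (k : nat) (h : R) : vec :=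
  fun j => if Nat.eqb j k then h else p j.

Definition partial (k : nat) (F : vec -> R) : vec -> R :=
  fun p => Derive (fun h => F (upd p k h)) (p k).

Fixpoint Ck (n k : nat) (O : vec -> Prop) (F : vec -> R) : Prop :=
  match k with
  | 0%nat => forall p, O p -> cont_at n F p
  | S k' => forall j, (j < n)%nat ->
      (forall p, O p -> ex_derive (fun h => F (upd p j h)) (p j))
      /\ Ck n k' O (partial j F)
  end.

(** [D] need not be open: smooth on [D] means smooth on an open neighbourhood. *)
Definition smooth_on (n : nat) (D : vec -> Prop) (F : vec -> R) : Prop :=
  exists O, open_n n O /\ (forall p, D p -> O p) /\ forall k, Ck n k O F.

Definition smooth1 (I : R -> Prop) (f : R -> R) : Prop :=
  forall n x, I x -> ex_derive_n f n x.

(** Functions on R/Z are 1-periodic functions on R. *)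

Definition smooth_S1 (f : R -> R) : Prop :=
  (forall x, f (x + 1) = f x) /\ smooth1 (fun _ => True) f.

Definition C0inf (f : R -> R) : Prop := smooth_S1 f /\ RInt f 0 1 = 0.

Definition Q (u g : R -> R) : R -> R := fun x =>
  RInt g 0 x
  - RInt (fun y => / u y * RInt g 0 y) 0 1 * / RInt (fun y => / u y) 0 1.

(** The coordinates of R^7 are numbered [x^0 .. x^3 = 0 .. 3] and
    [theta^1, theta^2, theta^3 = 4, 5, 6]. *)

Inductive idx := i1 | i2 | i3.

Definition idx_num (i : idx) : nat :=
  match i with i1 => 1 | i2 => 2 | i3 => 3 end.

Definition sum3 (F : idx -> R) : R := F i1 + F i2 + F i3.

Definition oneform := vec -> R.
Definition twoform := vec -> vec -> R.
Definition threeform := vec -> vec -> vec -> R.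

Definition wedge11 (a b : oneform) : twoform :=
  fun v w => a v * b w - a w * b v.

Definition wedge12 (a : oneform) (b : twoform) : threeform :=
  fun v1 v2 v3 => a v1 * b v2 v3 - a v2 * b v1 v3 + a v3 * b v1 v2.

Definition dx (j : nat) : oneform := fun v => v j.
Definition dtheta (i : idx) : oneform := fun v => v (3 + idx_num i)%nat.
Definition dxx (j k : nat) : twoform := wedge11 (dx j) (dx k).

Definition omegaK (i : idx) : twoform := fun v w =>
  match i with
  | i1 => dxx 0 1 v w + dxx 2 3 v w
  | i2 => dxx 0 2 v w + dxx 3 1 v w
  | i3 => dxx 0 3 v w + dxx 1 2 v w
  end.

Definition phiK : threeform := fun v1 v2 v3 =>
  wedge12 (dtheta i1) (wedge11 (dtheta i2) (dtheta i3)) v1 v2 v3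
  - sum3 (fun i => wedge12 (dtheta i) (omegaK i) v1 v2 v3).

(** [eta i] is dtheta^i /\ dx^{0i}. *)
Definition eta (i : idx) : threeform := wedge12 (dtheta i) (dxx 0 (idx_num i)).

Definition form_field := vec -> threeform.

Definition std_basis (k : nat) : vec := fun j => if Nat.eqb j k then 1 else 0.

Definition vadd (v w : vec) : vec := fun k => v k + w k.
Definition vscale (c : R) (v : vec) : vec := fun k => c * v k.

Definition alternating (w : threeform) : Prop :=
  (forall a b v1 v1' v2 v3,
     w (vadd (vscale a v1) (vscale b v1')) v2 v3 = a * w v1 v2 v3 + b * w v1' v2 v3)
  /\ (forall v1 v2 v3, w v2 v1 v3 = - w v1 v2 v3)
  /\ (forall v1 v2 v3, w v1 v3 v2 = - w v1 v2 v3)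
  /\ (forall v1 v1' v2 v3, (forall k, (k < 7)%nat -> v1 k = v1' k) ->
        w v1 v2 v3 = w v1' v2 v3).

Definition smooth_form_T7 (alpha : form_field) : Prop :=
  (forall p, alternating (alpha p))
  /\ (forall v1 v2 v3, smooth_on 7 (fun _ => True) (fun p => alpha p v1 v2 v3))
  /\ (forall p k v1 v2 v3, (k < 7)%nat ->
        alpha (vadd p (std_basis k)) v1 v2 v3 = alpha p v1 v2 v3).

Definition dir_derive (F : vec -> R) (p v : vec) : R :=
  Derive (fun h => F (vadd p (vscale h v))) 0.

Definition ext_d (alpha : form_field) (p v0 v1 v2 v3 : vec) : R :=
  dir_derive (fun q => alpha q v1 v2 v3) p v0
  - dir_derive (fun q => alpha q v0 v2 v3) p v1
  + dir_derive (fun q => alpha q v0 v1 v3) p v2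
  - dir_derive (fun q => alpha q v0 v1 v2) p v3.

Definition closed_form (alpha : form_field) : Prop :=
  forall p v0 v1 v2 v3, ext_d alpha p v0 v1 v2 v3 = 0.

Definition matvec (A : nat -> nat -> R) (v : vec) : vec :=
  fun a => sum_f_R0 (fun b => A a b * v b) 6.

(** A G2-structure is a 3-form lying pointwise in the GL(7)-orbit of the flat
    model, for which we take [phiK]. *)
Definition definite (w : threeform) : Prop :=
  exists A B : nat -> nat -> R,
    (forall a c, (a < 7)%nat -> (c < 7)%nat ->
       sum_f_R0 (fun b => A a b * B b c) 6 = if Nat.eqb a c then 1 else 0)
    /\ forall v1 v2 v3, w v1 v2 v3 = phiK (matvec A v1) (matvec A v2) (matvec A v3).

Definition closed_G2_structure (alpha : form_field) : Prop :=
  smooth_form_T7 alpha /\ closed_form alpha /\ (forall p, definite (alpha p)).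

Definition triple := idx -> form_field.

Definition teq (X Y : triple) : Prop :=
  forall i p v1 v2 v3, X i p v1 v2 v3 = Y i p v1 v2 v3.
Definition tadd (X Y : triple) : triple :=
  fun i p v1 v2 v3 => X i p v1 v2 v3 + Y i p v1 v2 v3.
Definition tscale (c : R) (X : triple) : triple :=
  fun i p v1 v2 v3 => c * X i p v1 v2 v3.
Definition tzero : triple := fun _ _ _ _ _ => 0.

Definition M3 (phi : triple) : Prop :=
  (forall i, closed_G2_structure (phi i))
  /\ exists u : idx -> R -> R,
       (forall i, smooth_S1 (u i) /\ (forall x, 0 < u i x) /\ RInt (u i) 0 1 = 1)
       /\ teq phi (fun i p v1 v2 v3 =>
                     phiK v1 v2 v3 - (u i (p 0%nat) - 1) * eta i v1 v2 v3).

Definition T3 (X : triple) : Prop :=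
  exists f : idx -> R -> R,
    (forall i, C0inf (f i))
    /\ teq X (fun i p v1 v2 v3 => - (f i (p 0%nat) * eta i v1 v2 v3)).

(** Minus the coefficient of dtheta^i /\ dx^{0i} along the x_0-circle: [u_i] for
    a point of [M3] (the coefficient in [phiK] is -1), [f_i] for a tangent vector. *)
Definition coef (X : triple) (i : idx) : R -> R := fun x =>
  - X i (upd (fun _ => 0) 0 x) (std_basis (3 + idx_num i)) (std_basis 0) (std_basis (idx_num i)).

Definition metric (phi X Y : triple) : R :=
  sum3 (fun i =>
    RInt (fun x => / coef phi i x * Q (coef phi i) (coef X i) x
                   * Q (coef phi i) (coef Y i) x) 0 1).

Definition curve := R -> triple.
Definition family2 := R -> R -> triple.

Definition dcurve (Y : curve) (t : R) : triple :=
  fun i p v1 v2 v3 => Derive (fun tau => Y tau i p v1 v2 v3) t.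

Definition d1 (Phi : family2) : family2 := fun s t => dcurve (fun sg => Phi sg t) s.
Definition d2 (Phi : family2) : family2 := fun s t => dcurve (fun tau => Phi s tau) t.

(** Triples of the shape occurring here are determined by their coefficients, so
    smooth dependence on parameters is joint smoothness of the coefficients. *)
Definition smooth_curve (I : R -> Prop) (Y : curve) : Prop :=
  forall i, smooth_on 2 (fun p => I (p 0%nat))
                        (fun p => coef (Y (p 0%nat)) i (p 1%nat)).

Definition smooth_family (W : R -> R -> Prop) (Y : family2) : Prop :=
  forall i, smooth_on 3 (fun p => W (p 0%nat) (p 1%nat))
                        (fun p => coef (Y (p 0%nat) (p 1%nat)) i (p 2%nat)).

Definition curve_in_M3 (I : R -> Prop) (Phi : curve) : Prop :=
  (forall t, I t -> M3 (Phi t)) /\ smooth_curve I Phi.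
Definition field_along (I : R -> Prop) (Y : curve) : Prop :=
  (forall t, I t -> T3 (Y t)) /\ smooth_curve I Y.

Definition family_in_M3 (W : R -> R -> Prop) (Phi : family2) : Prop :=
  (forall s t, W s t -> M3 (Phi s t)) /\ smooth_family W Phi.
Definition field_along_family (W : R -> R -> Prop) (Y : family2) : Prop :=
  (forall s t, W s t -> T3 (Y s t)) /\ smooth_family W Y.

Definition open2 (W : R -> R -> Prop) : Prop :=
  open (fun q : R * R => W (fst q) (snd q)).

Definition is_interval (J : R -> Prop) : Prop :=
  forall x y z, J x -> J y -> x <= z <= y -> J z.

Definition concave_on (P : R -> Prop) (f : R -> R) : Prop :=
  forall x y l, P x -> P y -> 0 <= l <= 1 ->
    l * f x + (1 - l) * f y <= f (l * x + (1 - l) * y).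

(** A connection is given by its covariant derivative along curves: [D Phi Y t]
    is the derivative at [t] of the field [Y] along [Phi]. *)

Definition cov_derivative := curve -> curve -> curve.

Definition D1 (D : cov_derivative) (Phi Y : family2) : family2 :=
  fun s t => D (fun sg => Phi sg t) (fun sg => Y sg t) s.
Definition D2 (D : cov_derivative) (Phi Y : family2) : family2 :=
  fun s t => D (fun tau => Phi s tau) (fun tau => Y s tau) t.

(** The last clause is linearity in the direction of differentiation: the
    derivative along a curve in the parameter domain of a family is the
    combination of the two partial covariant derivatives. *)
Definition is_connection (D : cov_derivative) : Prop :=
  (forall I Phi Phi' Y Y', open I ->
     curve_in_M3 I Phi -> field_along I Y ->
     (forall t, I t -> teq (Phi t) (Phi' t) /\ teq (Y t) (Y' t)) ->
     forall t, I t -> teq (D Phi Y t) (D Phi' Y' t))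
  /\ (forall I Phi Y, open I ->
     curve_in_M3 I Phi -> field_along I Y -> field_along I (D Phi Y))
  /\ (forall W Phi Y, open2 W ->
     family_in_M3 W Phi -> field_along_family W Y ->
     field_along_family W (D1 D Phi Y) /\ field_along_family W (D2 D Phi Y))
  /\ (forall I Phi Y Z, open I ->
     curve_in_M3 I Phi -> field_along I Y -> field_along I Z ->
     forall t, I t ->
       teq (D Phi (fun tau => tadd (Y tau) (Z tau)) t)
           (tadd (D Phi Y t) (D Phi Z t)))
  /\ (forall I Phi Y c, open I ->
     curve_in_M3 I Phi -> field_along I Y -> smooth1 I c ->
     forall t, I t ->
       teq (D Phi (fun tau => tscale (c tau) (Y tau)) t)
           (tadd (tscale (Derive c t) (Y t)) (tscale (c t) (D Phi Y t))))
  /\ (forall W Phi Y J sg tau, open2 W -> open J ->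
     family_in_M3 W Phi -> field_along_family W Y ->
     smooth1 J sg -> smooth1 J tau -> (forall r, J r -> W (sg r) (tau r)) ->
     forall r, J r ->
       teq (D (fun a => Phi (sg a) (tau a)) (fun a => Y (sg a) (tau a)) r)
           (tadd (tscale (Derive sg r) (D1 D Phi Y (sg r) (tau r)))
                 (tscale (Derive tau r) (D2 D Phi Y (sg r) (tau r))))).

Definition torsion_free (D : cov_derivative) : Prop :=
  forall W Phi, open2 W -> family_in_M3 W Phi ->
  forall s t, W s t -> teq (D1 D Phi (d2 Phi) s t) (D2 D Phi (d1 Phi) s t).

Definition metric_compatible (D : cov_derivative) : Prop :=
  forall I Phi Y Z, open I ->
  curve_in_M3 I Phi -> field_along I Y -> field_along I Z ->
  forall t, I t ->
    is_derive (fun tau => metric (Phi tau) (Y tau) (Z tau)) t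
      (metric (Phi t) (D Phi Y t) (Z t) + metric (Phi t) (Y t) (D Phi Z t)).

Definition is_Levi_Civita (D : cov_derivative) : Prop :=
  is_connection D /\ torsion_free D /\ metric_compatible D.

Definition U (u f g : R -> R) : R -> R := fun x =>
  (f x * Q u g x + g x * Q u f x) / u x
  - Q u f x * Q u g x * Derive u x / (u x) ^ 2.

Definition covD : cov_derivative := fun Phi Y t =>
  fun i p v1 v2 v3 =>
    dcurve Y t i p v1 v2 v3
    + Derive (U (coef (Phi t) i) (coef (dcurve Phi t) i) (coef (Y t) i)) (p 0%nat)
      * eta i v1 v2 v3.

(** Parameter fields commute, so there is no bracket term. *)
Definition curvature (D : cov_derivative) (Phi Z : family2) : family2 := fun s t =>
  tadd (D1 D Phi (D2 D Phi Z) s t) (tscale (-1) (D2 D Phi (D1 D Phi Z) s t)).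

Definition independent (X Y : triple) : Prop :=
  forall a b, teq (tadd (tscale a X) (tscale b Y)) tzero -> a = 0 /\ b = 0.

(** [kappa] is the sectional curvature at [phi] of the plane spanned by [X], [Y],
    computed on a surface through [phi] with tangent vectors [X], [Y]. *)
Definition is_sectional_curvature (D : cov_derivative) (phi X Y : triple)
    (kappa : R) : Prop :=
  exists (W : R -> R -> Prop) (Phi : family2) (s t : R),
    open2 W /\ family_in_M3 W Phi /\ W s t
    /\ teq (Phi s t) phi /\ teq (d1 Phi s t) X /\ teq (d2 Phi s t) Y
    /\ kappa = metric phi (curvature D Phi (d2 Phi) s t) X
               / (metric phi X X * metric phi Y Y - (metric phi X Y) ^ 2).

Definition Utilde (u f : R -> R) : R -> R := fun x =>
  2 * f x * Q u f x / u x - (Q u f x) ^ 2 * Derive u x / (u x) ^ 2.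

Definition is_geodesic (I : R -> Prop) (Phi : curve) : Prop :=
  curve_in_M3 I Phi
  /\ forall t i x, I t ->
       Derive (fun tau => coef (dcurve Phi tau) i x) t
       = Derive (Utilde (coef (Phi t) i) (coef (dcurve Phi t) i)) x.

Definition Vol (chi : idx -> R -> R) (phi : triple) : R :=
  sum3 (fun i => RInt (fun x => chi i (coef phi i x)) 0 1).

Definition K (u f : R -> R) : R -> R := fun x => f x - Derive u x * Q u f x / u x.

(** The time is the first parameter; [J] may contain its end points. *)
Definition flow_family (chi : idx -> R -> R) (J : R -> Prop) (Phi : family2) : Prop :=
  family_in_M3 (fun t s => J t /\ 0 <= s <= 1) Phi
  /\ forall t s i x, J t -> 0 <= s <= 1 ->
       let u := coef (Phi t s) i in
       Derive (fun tau => coef (Phi tau s) i x) t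
       = - Derive (fun y => Derive_n (chi i) 2 (u y) * Derive u y * u y) x.

Definition speed2 (c : curve) (s : R) : R := metric (c s) (dcurve c s) (dcurve c s).

Definition curve_length (c : curve) : R := RInt (fun s => sqrt (speed2 c s)) 0 1.

(* Main.v *)
(** On the density [u], a variation [g] of zero mean is written [g = - (u z)'] with
    [z] of zero mean, so that [Q u g = - u z]: [z] is an Eulerian velocity and the
    metric becomes the kinetic energy [int u z w], as in Otto's calculus. In these
    terms the connection is the material derivative followed by a normalisation,
    [z_t + v z' - mu / u], where [v] is the velocity of [u] and [mu] is constant in
    [x]; compatibility with the metric and absence of torsion are then integration
    by parts and the symmetry of second derivatives. The same substitution turns
    [K] into [- u z'], which yields the second variation of the volume and the
    identity [d/dt int u z^2 = 2 int chi''(u) K^2] along the flow. The curvature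
    collapses to [3 (int v w')^2 / int (1 / u)] for the velocities [v], [w] of the
    two tangent vectors, the O'Neill term of the projection from diffeomorphisms to
    densities. *)

From Stdlib Require Import Reals Arith Lra Lia FunctionalExtensionality ClassicalEpsilon.
Require Import Defs.
From Coquelicot Require Import Coquelicot.
Open Scope R_scope.

(** * Smooth functions of finitely many variables *)

(** The circle variable and the parameters are treated alike: a curve or a family becomes one
    function of a [vec], the circle being coordinate [k] and the domain [O] a cylinder, invariant
    under changes of that coordinate. Statements about triples split into one density for each index
    and become rational identities between partial derivatives, modulo two kinds of terms that
    integration kills: [partial k] of a periodic function, and a constant along the circle times a
    function of zero mean. The main analytic input is that solving for the velocity preserves joint
    smoothness, because primitives and means depend smoothly on parameters. The factor 3 in the
    curvature is 2 + 1: absence of torsion makes the two unnormalised material derivatives of the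
    velocities differ by [2 mu / u], and the material derivative of [mu / u] in the nested covariant
    derivative contributes once more. Along the flow, positivity and the equation are known only on
    a closed rectangle of parameters. The calculus takes place in its interior, and monotonicity of
    the energy is carried to the boundary by continuity. *)

Lemma upd_same p k h : upd p k h k = h.
Proof. unfold upd. now rewrite Nat.eqb_refl. Qed.

Lemma upd_other p k h j : j <> k -> upd p k h j = p j.
Proof. intros H. unfold upd. now apply Nat.eqb_neq in H as ->. Qed.

Lemma upd_upd p k h h' : upd (upd p k h) k h' = upd p k h'.
Proof. apply functional_extensionality; intros j. unfold upd. now destruct (Nat.eqb j k). Qed.

Lemma upd_id p k : upd p k (p k) = p.
Proof.
  apply functional_extensionality; intros j. unfold upd.
  destruct (Nat.eqb j k) eqn:E; auto. apply Nat.eqb_eq in E. now subst.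
Qed.

Lemma upd_comm p j k a b : j <> k -> upd (upd p j a) k b = upd (upd p k b) j a.
Proof.
  intros H. apply functional_extensionality; intros i. unfold upd.
  destruct (Nat.eqb i k) eqn:E1, (Nat.eqb i j) eqn:E2; auto.
  apply Nat.eqb_eq in E1, E2. congruence.
Qed.

(** The filter behind [cont_at]; it gives access to the general lemmas on limits. *)
Definition nbhd (n : nat) (p : vec) : (vec -> Prop) -> Prop :=
  fun P => exists d, 0 < d /\ forall q, near_n n d p q -> P q.

Lemma near_n_le n d d' p q : d <= d' -> near_n n d p q -> near_n n d' p q.
Proof. intros H H1 k hk. specialize (H1 k hk). lra. Qed.

Global Instance nbhd_filter n p : Filter (nbhd n p).
Proof.
  split.
  - exists 1. split; [lra | auto].
  - intros P Q [d [hd H]] [d' [hd' H']]. exists (Rmin d d'). split.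
    { now apply Rmin_pos. }
    intros q hq. split; [apply H | apply H']; apply near_n_le with (2 := hq).
    + apply Rmin_l.
    + apply Rmin_r.
  - intros P Q H [d [hd H']]. exists d. auto.
Qed.

Lemma cont_at_lim n F p : cont_at n F p <-> filterlim F (nbhd n p) (locally (F p)).
Proof.
  split.
  - intros H. apply filterlim_locally. intros eps.
    destruct (H eps (cond_pos eps)) as [d [hd H1]]. exists d. split; auto.
  - intros H eps heps.
    destruct (proj1 (filterlim_locally _ _) H (mkposreal eps heps)) as [d [hd H1]].
    exists d. split; auto.
Qed.

Lemma nbhd_upd_line n p k a :
  filterlim (fun h => upd p k h) (locally a) (nbhd n (upd p k a)).
Proof.
  intros P [d [hd H]]. exists (mkposreal d hd). intros h hh. apply H.
  intros j hj. unfold upd. destruct (Nat.eqb j k).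
  - exact hh.
  - rewrite Rminus_diag, Rabs_R0. exact hd.
Qed.

Lemma nbhd_upd_plane n p j k a b :
  filterlim (fun z : R * R => upd (upd p j (fst z)) k (snd z))
    (locally (a, b)) (nbhd n (upd (upd p j a) k b)).
Proof.
  intros P [d [hd H]]. exists (mkposreal d hd). intros [h h'] [h1 h2]. apply H.
  intros i hi. unfold upd; simpl in *.
  destruct (Nat.eqb i k); [exact h2 |]. destruct (Nat.eqb i j); [exact h1 |].
  rewrite Rminus_diag, Rabs_R0. exact hd.
Qed.

Lemma cont_at_ext n O F G p :
  open_n n O -> O p -> (forall q, O q -> F q = G q) -> cont_at n F p -> cont_at n G p.
Proof.
  intros hO hp H. rewrite !cont_at_lim, <- (H p hp). apply filterlim_ext_loc.
  apply filter_imp with (P := O); auto. exact (hO p hp).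
Qed.

Lemma cont_at_const n c p : cont_at n (fun _ => c) p.
Proof. apply cont_at_lim. apply filterlim_const. Qed.

Lemma cont_at_coord n k p : (k < n)%nat -> cont_at n (fun q => q k) p.
Proof. intros hk eps heps. exists eps. split; auto. Qed.

Lemma cont_at_plus n F G p :
  cont_at n F p -> cont_at n G p -> cont_at n (fun q => F q + G q) p.
Proof.
  rewrite !cont_at_lim. intros HF HG.
  eapply filterlim_comp_2; [exact HF | exact HG | apply (filterlim_plus (F p) (G p))].
Qed.

Lemma cont_at_mult n F G p :
  cont_at n F p -> cont_at n G p -> cont_at n (fun q => F q * G q) p.
Proof.
  rewrite !cont_at_lim. intros HF HG.
  eapply filterlim_comp_2; [exact HF | exact HG | apply (filterlim_mult (F p) (G p))].
Qed.

Lemma cont_at_comp n F f p :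
  continuous f (F p) -> cont_at n F p -> cont_at n (fun q => f (F q)) p.
Proof. rewrite !cont_at_lim. intros Hf HF. exact (filterlim_comp _ _ _ _ _ _ _ _ HF Hf). Qed.

Lemma cont_at_inv n F p : F p <> 0 -> cont_at n F p -> cont_at n (fun q => / F q) p.
Proof. intros H. apply cont_at_comp. now apply continuous_Rinv. Qed.

Lemma cont_at_opp n F p : cont_at n F p -> cont_at n (fun q => - F q) p.
Proof.
  intros H. apply cont_at_ext with (O := fun _ => True) (F := fun q => (-1) * F q); auto.
  - intros q _. exists 1. split; [lra | auto].
  - intros q _. ring.
  - apply cont_at_mult; auto. apply cont_at_const.
Qed.

Lemma cont_at_upd n F p k c :
  cont_at n F (upd p k c) -> cont_at n (fun q => F (upd q k c)) p.
Proof.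
  intros H eps heps. destruct (H eps heps) as [d [hd Hd]]. exists d. split; auto.
  intros q hq. apply Hd. intros j hj. unfold upd. destruct (Nat.eqb j k); auto.
  rewrite Rminus_diag, Rabs_R0. exact hd.
Qed.

Lemma cont_at_line n F p k y :
  cont_at n F (upd p k y) -> continuous (fun h => F (upd p k h)) y.
Proof.
  rewrite cont_at_lim. intros H.
  exact (filterlim_comp _ _ _ _ _ _ _ _ (nbhd_upd_line n p k y) H).
Qed.

Lemma cont_at_plane n F p j k a b :
  cont_at n F (upd (upd p j a) k b) ->
  continuity_2d_pt (fun h h' => F (upd (upd p j h) k h')) a b.
Proof.
  rewrite cont_at_lim. intros H. apply continuity_2d_pt_filterlim.
  exact (filterlim_comp _ _ _ _ _ _ _ _ (nbhd_upd_plane n p j k a b) H).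
Qed.

Lemma open_line n O p k y :
  open_n n O -> O (upd p k y) -> locally y (fun h => O (upd p k h)).
Proof. intros hO hp. apply (nbhd_upd_line n p k y). exact (hO _ hp). Qed.

Lemma open_line0 n O p k :
  open_n n O -> O p -> locally (p k) (fun h => O (upd p k h)).
Proof. intros hO hp. apply open_line with n; auto. now rewrite upd_id. Qed.

Lemma Ck_ext n k O F G :
  open_n n O -> (forall p, O p -> F p = G p) -> Ck n k O F -> Ck n k O G.
Proof.
  intros hO. revert F G. induction k as [|k IH]; simpl; intros F G H HF.
  - intros p hp. now apply cont_at_ext with O F; auto.
  - intros j hj. destruct (HF j hj) as [H1 H2].
    assert (Hl : forall p, O p ->
        locally (p j) (fun h => F (upd p j h) = G (upd p j h))).
    { intros p hp. apply filter_imp with (2 := open_line0 n O p j hO hp). auto. }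
    split.
    + intros p hp. apply (ex_derive_ext_loc _ _ _ (Hl p hp)). auto.
    + apply IH with (partial j F); auto. intros p hp. apply Derive_ext_loc, Hl, hp.
Qed.

Lemma Ck_sub n k (O O' : vec -> Prop) F : (forall p, O' p -> O p) -> Ck n k O F -> Ck n k O' F.
Proof.
  intros H. revert F. induction k as [|k IH]; simpl; intros F HF; auto.
  intros j hj. destruct (HF j hj). split; auto.
Qed.

(** [Ck] at order [S k] demands derivatives along lines and order [k] for the partials, not
    continuity of [F] itself. The orders are not nested by definition, so all of them are
    required. *)
Definition Sm n O F := forall k, Ck n k O F.

Lemma Sm_cont n O F p : Sm n O F -> O p -> cont_at n F p.
Proof. intros H. exact (H 0%nat p). Qed.

Lemma Sm_partial n O F j : (j < n)%nat -> Sm n O F -> Sm n O (partial j F).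
Proof. intros hj H k. exact (proj2 (H (S k) j hj)). Qed.

Lemma Sm_is_derive n O F j p y :
  Sm n O F -> (j < n)%nat -> O (upd p j y) ->
  is_derive (fun h => F (upd p j h)) y (partial j F (upd p j y)).
Proof.
  intros H hj hp. destruct (H 1%nat j hj) as [H1 _]. specialize (H1 _ hp).
  unfold partial. rewrite upd_same in *.
  apply is_derive_ext with (2 := Derive_correct _ _ H1).
  intros h. now rewrite upd_upd.
Qed.

Lemma Sm_is_derive0 n O F j p :
  Sm n O F -> (j < n)%nat -> O p ->
  is_derive (fun h => F (upd p j h)) (p j) (partial j F p).
Proof.
  intros H hj hp. pose proof (Sm_is_derive n O F j p (p j) H hj) as H1.
  rewrite upd_id in H1. auto.
Qed.

Lemma Sm_ext n O F G :
  open_n n O -> (forall p, O p -> F p = G p) -> Sm n O F -> Sm n O G.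
Proof. intros hO H HF k. apply Ck_ext with F; auto. Qed.

Lemma Ck_const n k O c : Ck n k O (fun _ => c).
Proof.
  revert c. induction k as [|k IH]; simpl; intros c.
  - intros p _. apply cont_at_const.
  - intros j hj. split.
    + intros p _. apply ex_derive_const.
    + replace (partial j (fun _ => c)) with (fun _ : vec => 0); auto.
      apply functional_extensionality; intros p. unfold partial. now rewrite Derive_const.
Qed.

Lemma Sm_const n O c : Sm n O (fun _ => c).
Proof. intros k. apply Ck_const. Qed.

Lemma Ck_plus n k O F G : open_n n O ->
  Ck n k O F -> Ck n k O G -> Ck n k O (fun p => F p + G p).
Proof.
  intros hO. revert F G. induction k as [|k IH]; simpl; intros F G HF HG.
  - intros p hp. apply cont_at_plus; auto.
  - intros j hj. destruct (HF j hj) as [H1 H2], (HG j hj) as [H3 H4]. split.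
    + intros p hp. apply (ex_derive_plus (fun h => F (upd p j h)) (fun h => G (upd p j h))); auto.
    + apply Ck_ext with (fun p => partial j F p + partial j G p); auto.
      intros p hp. unfold partial. symmetry. apply Derive_plus; auto.
Qed.

(** The Leibniz rule pairs a partial of one factor with the other factor undifferentiated, so the
    lower orders have to be among the hypotheses. *)
Lemma Ck_mult n k O F G : open_n n O ->
  (forall m, (m <= k)%nat -> Ck n m O F) -> (forall m, (m <= k)%nat -> Ck n m O G) ->
  Ck n k O (fun p => F p * G p).
Proof.
  intros hO. revert F G. induction k as [|k IH]; intros F G HF HG.
  - intros p hp. apply cont_at_mult; [apply (HF 0%nat) | apply (HG 0%nat)]; auto.
  - intros j hj.
    destruct (HF 1%nat ltac:(lia) j hj) as [H1 _], (HG 1%nat ltac:(lia) j hj) as [H2 _].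
    assert (HF' : forall m, (m <= k)%nat -> Ck n m O (partial j F)).
    { intros m hm. exact (proj2 (HF (S m) ltac:(lia) j hj)). }
    assert (HG' : forall m, (m <= k)%nat -> Ck n m O (partial j G)).
    { intros m hm. exact (proj2 (HG (S m) ltac:(lia) j hj)). }
    split.
    + intros p hp. apply (ex_derive_mult (fun h => F (upd p j h)) (fun h => G (upd p j h))); auto.
    + apply Ck_ext with (fun p => partial j F p * G p + F p * partial j G p); auto.
      * intros p hp. unfold partial. rewrite Derive_mult; auto. now rewrite upd_id.
      * apply Ck_plus; auto.
Qed.

Lemma Sm_plus n O F G : open_n n O -> Sm n O F -> Sm n O G -> Sm n O (fun p => F p + G p).
Proof. intros hO HF HG k. now apply Ck_plus. Qed.

Lemma Sm_mult n O F G : open_n n O -> Sm n O F -> Sm n O G -> Sm n O (fun p => F p * G p).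
Proof. intros hO HF HG k. now apply Ck_mult. Qed.

Lemma Sm_opp n O F : open_n n O -> Sm n O F -> Sm n O (fun p => - F p).
Proof.
  intros hO HF. apply Sm_ext with (fun p => (-1) * F p); auto.
  - intros p _. ring.
  - apply Sm_mult; auto. apply Sm_const.
Qed.

(** The induction needs every derivative of the outer function at once, hence a sequence [phi] in
    which each term differentiates to the next. It serves both for iterated derivatives of a smooth
    function and for the explicit derivatives of the inverse. *)
Lemma Sm_comp_family n O F (P : R -> Prop) (phi : nat -> R -> R) m : open_n n O ->
  (forall m x, P x -> is_derive (phi m) x (phi (S m) x)) ->
  (forall p, O p -> P (F p)) -> Sm n O F -> Sm n O (fun p => phi m (F p)).
Proof.
  intros hO Hphi HP HF k.
  enough (H : forall m l, (l <= k)%nat -> Ck n l O (fun p => phi m (F p))) by (apply H; auto).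
  clear m. induction k as [|k IH]; intros m l hl.
  - replace l with 0%nat by lia. intros p hp. apply cont_at_comp.
    + apply (ex_derive_continuous (phi m)). eexists. apply Hphi. auto.
    + now apply Sm_cont with O.
  - destruct (Nat.eq_dec l (S k)) as [-> | hl']; [| apply IH; lia].
    intros j hj.
    assert (D : forall p, O p ->
      is_derive (fun h => phi m (F (upd p j h))) (p j) (partial j F p * phi (S m) (F p))).
    { intros p hp. apply (is_derive_comp (phi m) (fun h => F (upd p j h))).
      - rewrite upd_id. apply Hphi. auto.
      - now apply Sm_is_derive0 with n O. }
    split.
    + intros p hp. eexists. now apply D.
    + apply Ck_ext with (fun p => partial j F p * phi (S m) (F p)); auto.
      * intros p hp. symmetry. apply is_derive_unique. auto.
      * apply Ck_mult; auto. intros l _. now apply Sm_partial.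
Qed.

Lemma Sm_comp n O F (P : R -> Prop) f m : open_n n O ->
  smooth1 P f -> (forall p, O p -> P (F p)) -> Sm n O F ->
  Sm n O (fun p => Derive_n f m (F p)).
Proof.
  intros hO Hf. apply (Sm_comp_family n O F P (Derive_n f)); auto.
  intros l x hx. apply (Derive_correct (Derive_n f l)). exact (Hf (S l) x hx).
Qed.

Lemma Sm_inv n O F : open_n n O ->
  (forall p, O p -> F p <> 0) -> Sm n O F -> Sm n O (fun p => / F p).
Proof.
  intros hO H HF.
  (* The term of index [m] is the [m]-th derivative of [/ x]; the inverse itself is the term of
     index 0. *)
  apply Sm_ext with (fun p => (fun m x => (-1) ^ m * INR (fact m) * / x ^ S m) 0%nat (F p)); auto.
  - intros p hp. simpl. field. auto.
  - apply (Sm_comp_family n O F (fun x => x <> 0)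
             (fun m x => (-1) ^ m * INR (fact m) * / x ^ S m) 0); auto.
    intros m x hx. auto_derive.
    + now apply (pow_nonzero x (S m)).
    + change (fact (S m)) with (S m * fact m)%nat. rewrite mult_INR, S_INR.
      change (Init.Nat.pred (S m)) with m.
      destruct m; simpl; field; repeat split; auto using pow_nonzero.
Qed.

(** * Integration along one coordinate, with the others as parameters *)

Section Cylinder.

Context (n k : nat) (O : vec -> Prop) (hk : (k < n)%nat) (hO : open_n n O)
  (hc : forall p y, O p -> O (upd p k y)).

Lemma Sm_upd F c : Sm n O F -> Sm n O (fun p => F (upd p k c)).
Proof.
  intros HF m. revert F HF. induction m as [|m IH]; intros F HF.
  - intros p hp. apply cont_at_upd. apply Sm_cont with O; auto.
  - intros j hj. destruct (Nat.eq_dec j k) as [-> | hjk].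
    + assert (E : forall p, (fun h => F (upd (upd p k h) k c)) = (fun _ => F (upd p k c))).
      { intros p. apply functional_extensionality; intros h. now rewrite upd_upd. }
      split.
      * intros p hp. rewrite E. apply ex_derive_const.
      * apply Ck_ext with (fun _ => 0); auto using Ck_const.
        intros p hp. unfold partial. now rewrite E, Derive_const.
    + assert (D : forall p, O p -> is_derive (fun h => F (upd (upd p j h) k c)) (p j)
                                     (partial j F (upd p k c))).
      { intros p hp. pose proof (Sm_is_derive0 n O F j (upd p k c) HF hj (hc _ _ hp)) as H.
        rewrite upd_other in H by auto. revert H. apply is_derive_ext.
        intros h. now rewrite upd_comm. }
      split.
      * intros p hp. eexists. now apply D.
      * apply Ck_ext with (fun p => partial j F (upd p k c)); auto.
        -- intros p hp. symmetry. now apply is_derive_unique, D.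
        -- apply IH. now apply Sm_partial.
Qed.

Definition cont_on (F : vec -> R) := forall p, O p -> cont_at n F p.

Lemma cont_on_line F p y : cont_on F -> O p -> continuous (fun h => F (upd p k h)) y.
Proof. intros HF hp. apply cont_at_line with n. apply HF. auto. Qed.

Lemma cont_on_ex_RInt F p a b : cont_on F -> O p -> ex_RInt (fun h => F (upd p k h)) a b.
Proof.
  intros HF hp. apply (ex_RInt_continuous (V := R_CompleteNormedModule)).
  intros y _. now apply cont_on_line.
Qed.

(** Compactness of the segment: every point [t] has a radius [delta t] for which [F] varies by less
    than [eps / 2], and one radius [d] serves all of them. *)
Lemma cont_on_unif F p a b eps : cont_on F -> O p -> 0 < eps ->
  nbhd n p (fun q => forall y, a <= y <= b -> Rabs (F (upd q k y) - F (upd p k y)) <= eps).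
Proof.
  intros HF hp heps.
  assert (Hd : forall t, exists d : posreal, forall q, near_n n d (upd p k t) q ->
             Rabs (F q - F (upd p k t)) < eps / 2).
  { intros t. destruct (HF (upd p k t) (hc _ _ hp) (eps / 2)) as [d [hd H]]; [lra |].
    exists (mkposreal d hd). exact H. }
  set (delta := fun t => proj1_sig (constructive_indefinite_description _ (Hd t))).
  assert (Hdelta : forall t q, near_n n (delta t) (upd p k t) q ->
             Rabs (F q - F (upd p k t)) < eps / 2).
  { intros t. exact (proj2_sig (constructive_indefinite_description _ (Hd t))). }
  destruct (compactness_value_1d a b delta) as [d Hcp].
  exists d. split; [apply cond_pos |]. intros q hq y hy.
  (* [compactness_value_1d] provides its covering point under a double negation, hence the argument
     by contradiction. *)
  apply Rnot_lt_le. intros Hlt. apply (Hcp y hy). intros [t [ht [hyt hdt]]].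
  apply (Rlt_irrefl eps). apply Rlt_le_trans with (1 := Hlt).
  replace (F (upd q k y) - F (upd p k y))
    with ((F (upd q k y) - F (upd p k t)) + - (F (upd p k y) - F (upd p k t))) by ring.
  eapply Rle_trans; [apply Rabs_triang |]. rewrite Rabs_Ropp.
  assert (Rabs (F (upd q k y) - F (upd p k t)) < eps / 2).
  { apply Hdelta. intros j hj. unfold upd. destruct (Nat.eqb j k); auto.
    specialize (hq j hj). lra. }
  assert (Rabs (F (upd p k y) - F (upd p k t)) < eps / 2).
  { apply Hdelta. intros j hj. unfold upd. destruct (Nat.eqb j k); auto.
    rewrite Rminus_diag, Rabs_R0. apply cond_pos. }
  lra.
Qed.

Definition prim (F : vec -> R) (p : vec) : R := RInt (fun y => F (upd p k y)) 0 (p k).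

Lemma is_derive_prim F p : cont_on F -> O p ->
  is_derive (fun h => prim F (upd p k h)) (p k) (F p).
Proof.
  intros HF hp.
  apply is_derive_ext with (fun h => RInt (fun y => F (upd p k y)) 0 h).
  - intros h. unfold prim. rewrite upd_same. apply RInt_ext. intros y _. now rewrite upd_upd.
  - replace (F p) with ((fun y => F (upd p k y)) (p k)) by now rewrite upd_id.
    apply (is_derive_RInt (fun y => F (upd p k y)) _ 0).
    + apply filter_forall. intros b. apply (RInt_correct (fun y => F (upd p k y))).
      now apply (cont_on_ex_RInt F).
    + now apply cont_on_line.
Qed.

(** Passing from [p] to [q] changes both the end point and the integrand. The intermediate point
    [upd p k (q k)] separates the two effects: the end point is handled by differentiability along
    the line, the integrand by uniform closeness on [[-M, M]], which contains every end point at
    distance less than 1 from [p k]. *)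
Lemma cont_on_prim F : cont_on F -> cont_on (prim F).
Proof.
  intros HF p hp eps heps.
  set (M := Rabs (p k) + 1).
  assert (hM : 0 < M) by (unfold M; pose proof (Rabs_pos (p k)); lra).
  assert (Hc : nbhd n p (fun q => Rabs (prim F (upd p k (q k)) - prim F p) < eps / 2)).
  { assert (Hd := ex_derive_continuous _ _ (ex_intro _ _ (is_derive_prim F p HF hp))).
    pose proof (proj1 (filterlim_locally _ _) Hd (mkposreal (eps / 2) ltac:(lra))) as H.
    simpl in H. rewrite upd_id in H.
    assert (H2 := proj1 (cont_at_lim n (fun q => q k) p) (cont_at_coord n k p hk)).
    exact (H2 _ H). }
  assert (hU := cont_on_unif F p (-M) M (eps / 2 / M) HF hp
                  ltac:(apply Rdiv_lt_0_compat; lra)).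
  assert (hB : nbhd n p (fun q => Rabs (q k) < M)).
  { exists 1. split; [lra |]. intros q hq. specialize (hq k hk). unfold M.
    replace (q k) with ((q k - p k) + p k) by ring.
    eapply Rle_lt_trans; [apply Rabs_triang |]. lra. }
  destruct (filter_and _ _ (hO p hp) (filter_and _ _ Hc (filter_and _ _ hU hB)))
    as [d [hd H]].
  exists d. split; auto. intros q hq. destruct (H q hq) as [hOq [h1 [h2 h3]]].
  replace (prim F q - prim F p)
    with ((prim F q - prim F (upd p k (q k))) + (prim F (upd p k (q k)) - prim F p)) by ring.
  eapply Rle_lt_trans; [apply Rabs_triang |].
  enough (Rabs (prim F q - prim F (upd p k (q k))) <= eps / 2) by lra.
  unfold prim. rewrite upd_same.
  rewrite (RInt_ext (fun y => F (upd (upd p k (q k)) k y)) (fun y => F (upd p k y)))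
    by (intros; now rewrite upd_upd).
  assert (e1 := cont_on_ex_RInt F q 0 (q k) HF hOq).
  assert (e2 := cont_on_ex_RInt F p 0 (q k) HF hp).
  pose proof (is_RInt_minus _ _ _ _ _ _ (RInt_correct _ _ _ e1) (RInt_correct _ _ _ e2)) as HI.
  assert (hx : forall x, Rmin 0 (q k) <= x <= Rmax 0 (q k) -> - M <= x <= M).
  { intros x. apply Rabs_def2 in h3. unfold Rmin, Rmax.
    destruct (Rle_dec 0 (q k)); lra. }
  assert (HN := norm_RInt_le_const_abs (V := R_NormedModule)
    (fun y => minus (F (upd q k y)) (F (upd p k y))) _ _ _ (eps / 2 / M)
    (fun x h => h2 x (hx x h)) HI).
  eapply Rle_trans; [exact HN |]. rewrite Rminus_0_r.
  apply Rle_trans with (M * (eps / 2 / M)).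
  - apply Rmult_le_compat_r; [| lra]. apply Rlt_le, Rdiv_lt_0_compat; lra.
  - apply Req_le. field. lra.
Qed.

Lemma is_derive_prim_param F p j : Sm n O F -> (j < n)%nat -> j <> k -> O p ->
  is_derive (fun h => prim F (upd p j h)) (p j) (prim (partial j F) p).
Proof.
  intros HF hj hjk hp. unfold prim.
  apply is_derive_ext with (fun h => RInt (fun y => F (upd (upd p j h) k y)) 0 (p k)).
  { intros h. now rewrite upd_other by auto. }
  assert (E : forall h y, O (upd p j h) ->
    is_derive (fun z => F (upd (upd p j z) k y)) h (partial j F (upd (upd p j h) k y))).
  { intros h y hh. rewrite upd_comm by auto.
    apply is_derive_ext with (fun z => F (upd (upd p k y) j z)).
    - intros z. now rewrite upd_comm by auto.
    - apply Sm_is_derive with n O; auto. rewrite <- upd_comm by auto. auto. }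
  assert (hp' : O (upd p j (p j))) by now rewrite upd_id.
  replace (RInt (fun y => partial j F (upd p k y)) 0 (p k))
    with (RInt (fun y => Derive (fun z => F (upd (upd p j z) k y)) (p j)) 0 (p k)).
  2:{ apply RInt_ext. intros y _. etransitivity; [apply is_derive_unique, (E (p j) y hp') |].
      now rewrite upd_id. }
  assert (hl := open_line0 n O p j hO hp).
  apply (is_derive_RInt_param (fun h y => F (upd (upd p j h) k y))).
  - apply filter_imp with (2 := hl). intros h hh y _. eexists. now apply E.
  - intros y _.
    destruct hl as [d hd].
    apply (continuity_2d_pt_ext_loc (fun h y => partial j F (upd (upd p j h) k y))).
    + exists d. intros h y' hh _. symmetry. apply is_derive_unique, E, hd, hh.
    + apply cont_at_plane with n. apply Sm_cont with O; auto. now apply Sm_partial.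
  - apply filter_imp with (2 := hl). intros h hh.
    apply (cont_on_ex_RInt F (upd p j h)); auto. intros q hq. now apply Sm_cont with O.
Qed.

Lemma Sm_cont_on F : Sm n O F -> cont_on F.
Proof. intros H p hp. now apply Sm_cont with O. Qed.

(** The induction on the order closes because differentiation in [k] returns [F], while every other
    partial passes under the integral and returns the primitive of a partial of [F]. *)
Lemma Sm_prim F : Sm n O F -> Sm n O (prim F).
Proof.
  intros HF m. revert F HF. induction m as [|m IH]; intros F HF.
  - apply cont_on_prim. now apply Sm_cont_on.
  - intros j hj. destruct (Nat.eq_dec j k) as [-> | hjk].
    + assert (D := fun p => is_derive_prim F p (Sm_cont_on F HF)).
      split.
      * intros p hp. eexists. now apply D.
      * apply Ck_ext with F; auto. intros p hp. symmetry. now apply is_derive_unique, D.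
    + assert (D := fun p => is_derive_prim_param F p j HF hj hjk).
      split.
      * intros p hp. eexists. now apply D.
      * apply Ck_ext with (prim (partial j F)); auto.
        -- intros p hp. symmetry. now apply is_derive_unique, D.
        -- apply IH. now apply Sm_partial.
Qed.

Definition mean (F : vec -> R) (p : vec) : R := RInt (fun y => F (upd p k y)) 0 1.

(** Reduces the regularity of means to that of primitives. *)
Lemma mean_prim F p : mean F p = prim F (upd p k 1).
Proof.
  unfold mean, prim. rewrite upd_same. apply RInt_ext. intros y _. now rewrite upd_upd.
Qed.

Lemma Sm_mean F : Sm n O F -> Sm n O (mean F).
Proof.
  intros HF. apply Sm_ext with (fun p => prim F (upd p k 1)); auto.
  - intros p _. symmetry. apply mean_prim.
  - now apply Sm_upd, Sm_prim.
Qed.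

Lemma cont_on_mean F : cont_on F -> cont_on (mean F).
Proof.
  intros HF p hp. apply cont_at_ext with O (fun p => prim F (upd p k 1)); auto.
  - intros q _. symmetry. apply mean_prim.
  - apply cont_at_upd. apply cont_on_prim; auto.
Qed.

Lemma partial_mean F p j : Sm n O F -> (j < n)%nat -> j <> k -> O p ->
  partial j (mean F) p = mean (partial j F) p.
Proof.
  intros HF hj hjk hp. apply is_derive_unique.
  pose proof (is_derive_prim_param F (upd p k 1) j HF hj hjk (hc _ _ hp)) as H.
  rewrite <- mean_prim, upd_other in H by auto. revert H. apply is_derive_ext.
  intros h. now rewrite mean_prim, upd_comm.
Qed.

End Cylinder.

(** * Periodic functions and velocities *)

Lemma RInt_Rext (f g : R -> R) a b : (forall x, f x = g x) -> RInt f a b = RInt g a b.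
Proof. intros H. apply RInt_ext. auto. Qed.

Lemma RInt_Rplus (f g : R -> R) a b : ex_RInt f a b -> ex_RInt g a b ->
  RInt (fun x => f x + g x) a b = RInt f a b + RInt g a b.
Proof. exact (RInt_plus (V := R_CompleteNormedModule) f g a b). Qed.

Lemma RInt_Rscal (f : R -> R) c a b : ex_RInt f a b ->
  RInt (fun x => c * f x) a b = c * RInt f a b.
Proof. exact (RInt_scal (V := R_CompleteNormedModule) f a b c). Qed.

Lemma ex_RInt_Rcont (f : R -> R) a b : (forall x, continuous f x) -> ex_RInt f a b.
Proof. intros H. apply (ex_RInt_continuous (V := R_CompleteNormedModule)). auto. Qed.

Lemma derive0_const (f : R -> R) a b : (forall t, is_derive f t 0) -> f a = f b.
Proof.
  intros H. destruct (Rtotal_order a b) as [h | [-> | h]]; auto; [| symmetry];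
    apply (eq_is_derive f); auto; intros t _; apply H.
Qed.

(** Primitives of [g] differ by constants, and [Q u g] is the one orthogonal to [/ u]: the term
    subtracted in its definition is the constant that achieves this. *)
Lemma Q_unique (u g H : R -> R) x :
  (forall y, 0 < u y) -> (forall y, continuous u y) -> (forall y, continuous g y) ->
  (forall y, is_derive H y (g y)) -> RInt (fun y => / u y * H y) 0 1 = 0 ->
  Q u g x = H x.
Proof.
  intros hu cu cg dH hH.
  assert (E : forall y, RInt g 0 y = H y - H 0).
  { intros y. apply is_RInt_unique. apply (is_RInt_derive H g); auto. }
  assert (ci : forall y, continuous (fun y => / u y) y).
  { intros y. apply continuous_Rinv_comp; auto. apply Rgt_not_eq, hu. }
  assert (cH : forall y, continuous H y).
  { intros y. apply (ex_derive_continuous H). eexists. apply dH. }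
  assert (ei : ex_RInt (fun y => / u y) 0 1) by now apply ex_RInt_Rcont.
  assert (hi : 0 < RInt (fun y => / u y) 0 1).
  { apply RInt_gt_0; [lra | intros; apply Rinv_0_lt_compat, hu | auto]. }
  unfold Q. rewrite (RInt_ext (fun y => / u y * RInt g 0 y)
    (fun y => / u y * H y + - H 0 * / u y)) by (intros y _; rewrite E; simpl; ring).
  rewrite RInt_Rplus, RInt_Rscal, hH, E; auto.
  - field. lra.
  - apply ex_RInt_Rcont. intros y. apply (continuous_mult (fun y => / u y) H); auto.
  - apply (ex_RInt_scal (V := R_NormedModule)). auto.
Qed.

Section Periodic.

Context (n k : nat) (O : vec -> Prop) (hk : (k < n)%nat) (hO : open_n n O)
  (hc : forall p y, O p -> O (upd p k y)).

Definition SP (F : vec -> R) : Prop :=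
  Sm n O F /\ forall p, O p -> F (upd p k (p k + 1)) = F p.

Lemma SP_const c : SP (fun _ => c).
Proof. split; auto. apply Sm_const. Qed.

Lemma SP_plus F G : SP F -> SP G -> SP (fun q => F q + G q).
Proof.
  intros [H1 H2] [H3 H4]. split; [now apply Sm_plus |]. intros p hp. now rewrite H2, H4.
Qed.

Lemma SP_mult F G : SP F -> SP G -> SP (fun q => F q * G q).
Proof.
  intros [H1 H2] [H3 H4]. split; [now apply Sm_mult |]. intros p hp. now rewrite H2, H4.
Qed.

Lemma SP_opp F : SP F -> SP (fun q => - F q).
Proof. intros [H1 H2]. split; [now apply Sm_opp |]. intros p hp. now rewrite H2. Qed.

Lemma SP_minus F G : SP F -> SP G -> SP (fun q => F q - G q).
Proof. intros HF HG. apply (SP_plus F (fun q => - G q)); auto. now apply SP_opp. Qed.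

Lemma SP_inv F : (forall p, O p -> F p <> 0) -> SP F -> SP (fun q => / F q).
Proof.
  intros H [H1 H2]. split; [now apply Sm_inv |]. intros p hp. now rewrite H2.
Qed.

Lemma SP_div F G : SP F -> (forall p, O p -> G p <> 0) -> SP G -> SP (fun q => F q / G q).
Proof. intros HF H HG. apply (SP_mult F (fun q => / G q)); auto. now apply SP_inv. Qed.

Lemma SP_comp F (P : R -> Prop) f m :
  smooth1 P f -> (forall p, O p -> P (F p)) -> SP F -> SP (fun q => Derive_n f m (F q)).
Proof.
  intros H H' [H1 H2]. split; [now apply Sm_comp with P |]. intros p hp. now rewrite H2.
Qed.

Lemma SP_ext F G : (forall p, O p -> F p = G p) -> SP F -> SP G.
Proof.
  intros H [H1 H2]. split; [now apply Sm_ext with F |].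
  intros p hp. rewrite <- !H; auto.
Qed.

Lemma SP_partial F j : (j < n)%nat -> SP F -> SP (partial j F).
Proof.
  intros hj [H1 H2]. split; [now apply Sm_partial |]. intros p hp.
  destruct (Nat.eq_dec j k) as [-> | hjk].
  - pose proof (Sm_is_derive n O F k p (p k + 1) H1 hk (hc _ _ hp)) as D.
    symmetry. apply is_derive_unique.
    apply (is_derive_ext (fun h => F (upd p k (h + 1)))).
    + intros h. rewrite <- (H2 (upd p k h)), upd_upd, upd_same; auto.
    + replace (partial k F (upd p k (p k + 1))) with (1 * partial k F (upd p k (p k + 1))) by ring.
      apply (is_derive_comp (fun h => F (upd p k h)) (fun h => h + 1)); auto.
      auto_derive; auto.
  - unfold partial. rewrite upd_other by auto. apply Derive_ext_loc.
    apply filter_imp with (2 := open_line0 n O p j hO hp). intros h hh.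
    rewrite <- (H2 (upd p j h) hh), upd_other by auto. now rewrite upd_comm.
Qed.

Lemma SP_line F p y : SP F -> O p -> continuous (fun h => F (upd p k h)) y.
Proof. intros [H _] hp. apply (cont_on_line n k O hc); auto. now apply Sm_cont_on. Qed.

Lemma SP_ex_RInt F p a b : SP F -> O p -> ex_RInt (fun h => F (upd p k h)) a b.
Proof. intros H hp. apply ex_RInt_Rcont. intros y. now apply SP_line. Qed.

Lemma SP_is_derive F j p : SP F -> (j < n)%nat -> O p ->
  is_derive (fun h => F (upd p j h)) (p j) (partial j F p).
Proof. intros [H _]. now apply Sm_is_derive0. Qed.

Lemma SP_smooth_S1 F p : SP F -> O p -> smooth_S1 (fun y => F (upd p k y)).
Proof.
  intros HF hp. split.
  - intros x. destruct HF as [_ H]. rewrite <- (H (upd p k x)), upd_upd, upd_same; auto.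
  - intros m x _. revert x.
    (* The derivative of order [m] is carried along as the restriction of an [SP] function, which
       makes the next differentiation possible. *)
    assert (H : forall m, (forall x, ex_derive_n (fun y => F (upd p k y)) m x)
              /\ exists G, SP G /\ forall x, Derive_n (fun y => F (upd p k y)) m x = G (upd p k x)).
    { induction m0 as [|m0 [IH1 [G [HG IH2]]]].
      - split; [exact (fun _ => Logic.I) |]. now exists F.
      - assert (D : forall x, is_derive (Derive_n (fun y => F (upd p k y)) m0) x (partial k G (upd p k x))).
        { intros x. apply is_derive_ext with (fun y => G (upd p k y)); auto.
          apply Sm_is_derive with n O; auto. apply HG. }
        split.
        + intros x. eexists. apply D.
        + exists (partial k G). split; [now apply SP_partial |].
          intros x. now apply is_derive_unique, D. }
    apply H.
Qed.

Lemma partial_ext F G j p : (forall q, O q -> F q = G q) -> O p -> partial j F p = partial j G p.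
Proof.
  intros H hp. apply Derive_ext_loc.
  apply filter_imp with (2 := open_line0 n O p j hO hp). auto.
Qed.

Lemma partial_const c j p : partial j (fun _ => c) p = 0.
Proof. exact (Derive_const c (p j)). Qed.

Lemma partial_plus F G j p : SP F -> SP G -> (j < n)%nat -> O p ->
  partial j (fun q => F q + G q) p = partial j F p + partial j G p.
Proof.
  intros HF HG hj hp. apply is_derive_unique.
  apply (is_derive_plus (fun h => F (upd p j h)) (fun h => G (upd p j h))); now apply SP_is_derive.
Qed.

Lemma partial_opp F j p : partial j (fun q => - F q) p = - partial j F p.
Proof. unfold partial. apply Derive_opp. Qed.

Lemma partial_minus F G j p : SP F -> SP G -> (j < n)%nat -> O p ->
  partial j (fun q => F q - G q) p = partial j F p - partial j G p.
Proof.
  intros HF HG hj hp. apply is_derive_unique.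
  apply (is_derive_minus (fun h => F (upd p j h)) (fun h => G (upd p j h))); now apply SP_is_derive.
Qed.

Lemma partial_mult F G j p : SP F -> SP G -> (j < n)%nat -> O p ->
  partial j (fun q => F q * G q) p = partial j F p * G p + F p * partial j G p.
Proof.
  intros HF HG hj hp. unfold partial.
  rewrite (Derive_mult (fun h => F (upd p j h)) (fun h => G (upd p j h))).
  - now rewrite upd_id.
  - eexists. now apply SP_is_derive.
  - eexists. now apply SP_is_derive.
Qed.

Lemma partial_div F G j p : SP F -> SP G -> (forall q, O q -> G q <> 0) -> (j < n)%nat -> O p ->
  partial j (fun q => F q / G q) p = partial j F p / G p - F p * partial j G p / (G p * G p).
Proof.
  intros HF HG H hj hp. unfold partial.
  rewrite (Derive_div (fun h => F (upd p j h)) (fun h => G (upd p j h))).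
  - rewrite upd_id. field. auto.
  - eexists. now apply SP_is_derive.
  - eexists. now apply SP_is_derive.
  - rewrite upd_id. auto.
Qed.

Lemma partial_comp F (P : R -> Prop) f m j p :
  smooth1 P f -> (forall p, O p -> P (F p)) -> SP F -> (j < n)%nat -> O p ->
  partial j (fun q => Derive_n f m (F q)) p = Derive_n f (S m) (F p) * partial j F p.
Proof.
  intros Hf HP HF hj hp. unfold partial at 1.
  rewrite (Derive_comp (Derive_n f m) (fun h => F (upd p j h))).
  - rewrite upd_id. simpl. unfold partial. ring.
  - rewrite upd_id. exact (Hf (S m) _ (HP p hp)).
  - eexists. now apply SP_is_derive.
Qed.

Lemma partial_swap F i j p : SP F -> (i < n)%nat -> (j < n)%nat -> i <> j -> O p ->
  partial i (partial j F) p = partial j (partial i F) p.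
Proof.
  intros [HF _] hi hj hij hp.
  assert (D1 : forall G a b, Sm n O G -> O (upd (upd p i a) j b) ->
    is_derive (fun z => G (upd (upd p i z) j b)) a (partial i G (upd (upd p i a) j b))).
  { intros G a b HG hq. rewrite upd_comm in hq |- * by auto.
    apply is_derive_ext with (fun z => G (upd (upd p j b) i z)).
    - intros z. now rewrite upd_comm by auto.
    - now apply Sm_is_derive with n O. }
  assert (D2 : forall G a b, Sm n O G -> O (upd (upd p i a) j b) ->
    is_derive (fun z => G (upd (upd p i a) j z)) b (partial j G (upd (upd p i a) j b))).
  { intros G a b HG hq. now apply Sm_is_derive with n O. }
  set (f := fun a b => F (upd (upd p i a) j b)).
  assert (hl : locally_2d (fun a b => O (upd (upd p i a) j b)) (p i) (p j)).
  { apply locally_2d_locally. apply (nbhd_upd_plane n p i j (p i) (p j)).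
    rewrite upd_id, upd_id. exact (hO p hp). }
  assert (E1 : forall a b, O (upd (upd p i a) j b) ->
    Derive (fun t => f a t) b = partial j F (upd (upd p i a) j b)).
  { intros a b hq. now apply is_derive_unique, D2. }
  assert (E2 : forall a b, O (upd (upd p i a) j b) ->
    Derive (fun t => f t b) a = partial i F (upd (upd p i a) j b)).
  { intros a b hq. now apply is_derive_unique, D1. }
  assert (D12 : forall a b, O (upd (upd p i a) j b) ->
    is_derive (fun z => Derive (fun t => f z t) b) a (partial i (partial j F) (upd (upd p i a) j b))).
  { intros a b hq. apply (is_derive_ext_loc (fun z => partial j F (upd (upd p i z) j b))).
    - assert (H : locally a (fun z => O (upd (upd p j b) i z)))
        by (apply open_line with n; auto; now rewrite <- upd_comm by auto).
      apply filter_imp with (2 := H). intros z hz. rewrite <- upd_comm in hz by auto.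
      symmetry. auto.
    - apply D1; auto. now apply Sm_partial. }
  assert (D21 : forall a b, O (upd (upd p i a) j b) ->
    is_derive (fun z => Derive (fun t => f t z) a) b (partial j (partial i F) (upd (upd p i a) j b))).
  { intros a b hq. apply (is_derive_ext_loc (fun z => partial i F (upd (upd p i a) j z))).
    - apply filter_imp with (2 := open_line n O (upd p i a) j b hO hq). intros z hz.
      symmetry. auto.
    - apply D2; auto. now apply Sm_partial. }
  assert (hp' : upd (upd p i (p i)) j (p j) = p) by now rewrite upd_id, upd_id.
  assert (hq : O (upd (upd p i (p i)) j (p j))) by now rewrite hp'.
  assert (e12 := is_derive_unique _ _ _ (D12 _ _ hq)).
  assert (e21 := is_derive_unique _ _ _ (D21 _ _ hq)).
  rewrite hp' in e12, e21. etransitivity; [exact (eq_sym e12) |].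
  etransitivity; [| exact e21]. apply Schwarz.
  - apply locally_2d_impl with (2 := hl). apply locally_2d_forall. intros a b h.
    repeat split; eexists; [apply D1 | apply D2 | apply D12 | apply D21]; auto.
  - apply (continuity_2d_pt_ext_loc (fun a b => partial i (partial j F) (upd (upd p i a) j b))).
    + apply locally_2d_impl with (2 := hl). apply locally_2d_forall. intros a b h.
      symmetry. now apply is_derive_unique, D12.
    + apply cont_at_plane with n. apply Sm_cont with O; auto.
      apply Sm_partial; auto. apply Sm_partial; auto.
  - apply (continuity_2d_pt_ext_loc (fun a b => partial j (partial i F) (upd (upd p i a) j b))).
    + apply locally_2d_impl with (2 := hl). apply locally_2d_forall. intros a b h.
      symmetry. now apply is_derive_unique, D21.
    + apply cont_at_plane with n. apply Sm_cont with O; auto.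
      apply Sm_partial; auto. apply Sm_partial; auto.
Qed.

(** Typical members are means and the constants that normalise velocities; they factor out of
    [mean]. *)
Definition kconst (c : vec -> R) : Prop := forall p y, O p -> c (upd p k y) = c p.

Lemma mean_upd F p y : mean k F (upd p k y) = mean k F p.
Proof. unfold mean. apply RInt_ext. intros x _. now rewrite upd_upd. Qed.

Lemma kconst_partial c j p : kconst c -> j <> k -> O p -> forall y,
  partial j c (upd p k y) = partial j c p.
Proof.
  intros H hj hp y. unfold partial. rewrite upd_other by auto. apply Derive_ext_loc.
  apply filter_imp with (2 := open_line0 n O p j hO hp). intros h hh.
  now rewrite upd_comm, H by auto.
Qed.

Lemma kconst_partial_self c p : kconst c -> O p -> partial k c p = 0.
Proof.
  intros H hp. unfold partial. rewrite (Derive_ext _ (fun _ => c p)).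
  - apply Derive_const.
  - intros h. now apply H.
Qed.

Lemma partial_self_kconst c : SP c -> (forall p, O p -> partial k c p = 0) -> kconst c.
Proof.
  intros Hc H.
  assert (D : forall p y, O p -> is_derive (fun h => c (upd p k h)) y 0).
  { intros p y hp. rewrite <- (H (upd p k y)) by auto.
    apply Sm_is_derive with n O; auto. apply Hc. }
  intros p y hp. pose proof (derive0_const _ y (p k) (fun t => D p t hp)) as K.
  cbv beta in K. now rewrite upd_id in K.
Qed.

Lemma SP_mean F : SP F -> SP (mean k F).
Proof. intros [H _]. split; [now apply Sm_mean |]. intros p _. apply mean_upd. Qed.

Lemma mean_ext F G p : (forall q, O q -> F q = G q) -> O p -> mean k F p = mean k G p.
Proof. intros H hp. apply RInt_ext. intros y _. auto. Qed.

Lemma mean_plus F G p : SP F -> SP G -> O p ->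
  mean k (fun q => F q + G q) p = mean k F p + mean k G p.
Proof.
  intros HF HG hp.
  apply (RInt_Rplus (fun y => F (upd p k y)) (fun y => G (upd p k y))); now apply SP_ex_RInt.
Qed.

Lemma mean_scal c F p : kconst c -> SP F -> O p ->
  mean k (fun q => c q * F q) p = c p * mean k F p.
Proof.
  intros Hc HF hp. unfold mean.
  rewrite <- (RInt_Rscal (fun y => F (upd p k y))) by now apply SP_ex_RInt.
  apply RInt_ext. intros y _. now rewrite Hc.
Qed.

Lemma mean_opp F p : SP F -> O p -> mean k (fun q => - F q) p = - mean k F p.
Proof.
  intros HF hp. rewrite (mean_ext _ (fun q => (-1) * F q)); auto.
  - rewrite (mean_scal (fun _ => -1)); auto; [ring |]. now intros q y _.
  - intros. ring.
Qed.

Lemma mean_minus F G p : SP F -> SP G -> O p ->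
  mean k (fun q => F q - G q) p = mean k F p - mean k G p.
Proof.
  intros HF HG hp. rewrite (mean_plus F (fun q => - G q)) by auto using SP_opp.
  now rewrite mean_opp.
Qed.

Lemma mean_partial_self F p : SP F -> O p -> mean k (partial k F) p = 0.
Proof.
  intros HF hp.
  assert (H : is_RInt (fun y => partial k F (upd p k y)) 0 1
                (minus (F (upd p k 1)) (F (upd p k 0)))).
  { apply (is_RInt_derive (fun y => F (upd p k y))).
    - intros y _. apply Sm_is_derive with n O; auto. apply HF.
    - intros y _. apply SP_line; auto. now apply SP_partial. }
  unfold mean. etransitivity; [exact (is_RInt_unique _ _ _ _ H) |].
  destruct HF as [_ HF].
  replace (F (upd p k 1)) with (F (upd p k 0)).
  - apply Rminus_diag.
  - rewrite <- (HF (upd p k 0)) by auto. now rewrite upd_upd, upd_same, Rplus_0_l.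
Qed.

(** Equality up to an [x_k]-derivative suffices: this is integration by parts. *)
Lemma mean_eq_exact F G B p : SP F -> SP G -> SP B ->
  (forall q, O q -> F q = G q + partial k B q) -> O p -> mean k F p = mean k G p.
Proof.
  intros HF HG HB H hp. rewrite (mean_ext F _ p H hp).
  rewrite mean_plus, mean_partial_self; auto using SP_partial. ring.
Qed.

Lemma SP_partial_mean F j p : SP F -> (j < n)%nat -> j <> k -> O p ->
  partial j (mean k F) p = mean k (partial j F) p.
Proof. intros [H _] hj hjk hp. now apply partial_mean with n O. Qed.

Lemma mean_pos F p : SP F -> (forall q, O q -> 0 < F q) -> O p -> 0 < mean k F p.
Proof.
  intros HF H hp. apply RInt_gt_0; [lra | auto |]. intros y _. now apply SP_line.
Qed.

Lemma mean_nonneg F p : SP F -> (forall q, O q -> 0 <= F q) -> O p -> 0 <= mean k F p.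
Proof.
  intros HF H hp. apply RInt_ge_0; [lra | now apply SP_ex_RInt | auto].
Qed.

Lemma SP_pos_neq u : (forall p, O p -> 0 < u p) -> forall p, O p -> u p <> 0.
Proof. intros H p hp. apply Rgt_not_eq. exact (H p hp). Qed.

(** Hypotheses are matched syntactically; the second clause undoes the eta-expansion left by the
    rules for sums and products. *)
Ltac sp :=
  repeat match goal with
  | H : ?P |- ?G => constr_eq P G; exact H
  | H : SP ?F |- SP (fun q => ?G q) => constr_eq F G; exact H
  | |- forall p, O p -> _ => assumption
  | |- SP (fun _ => ?c) => apply SP_const
  | |- SP (fun q => @?F q + @?G q) => apply (SP_plus F G)
  | |- SP (fun q => @?F q - @?G q) => apply (SP_minus F G)
  | |- SP (fun q => @?F q / @?G q) => apply (SP_div F G)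
  | |- SP (fun q => @?F q * @?G q) => apply (SP_mult F G)
  | |- SP (fun q => - @?F q) => apply (SP_opp F)
  | |- SP (fun q => / @?F q) => apply (SP_inv F)
  | |- SP (fun q => partial ?j ?F q) => apply (SP_partial F j)
  | |- SP (partial ?j ?F) => apply (SP_partial F j)
  | |- SP (fun q => mean k ?F q) => apply (SP_mean F)
  | |- SP (mean k ?F) => apply (SP_mean F)
  end.

Ltac dd :=
  repeat first
    [ rewrite partial_const | rewrite partial_opp
    | rewrite partial_plus by sp | rewrite partial_minus by sp
    | rewrite partial_mult by sp | rewrite partial_div by sp ].

(** The continuity equation for the variation [g] of the density [u]; the zero mean
    of [z] makes it unique. *)
Definition vel (u g z : vec -> R) : Prop :=
  SP z /\ (forall p, O p -> mean k z p = 0)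
  /\ forall p, O p -> g p = - partial k (fun q => u q * z q) p.

(** [mQ], [mU] and [mG] are [Q], [U] and a summand of [metric] on the circle
    through [p] in the direction [k], [p] carrying the parameters; [mD j] is the
    coefficient of [covD] along the parameter [j]. *)
Definition mQ (u g : vec -> R) (p : vec) : R :=
  Q (fun y => u (upd p k y)) (fun y => g (upd p k y)) (p k).

Definition mU (u f g : vec -> R) (p : vec) : R :=
  U (fun y => u (upd p k y)) (fun y => f (upd p k y)) (fun y => g (upd p k y)) (p k).

Definition mD (j : nat) (u g : vec -> R) (p : vec) : R :=
  partial j g p - partial k (mU u (partial j u) g) p.

(** * The covariant derivative in terms of velocities *)

Section Density.

Context (u : vec -> R) (Hu : SP u) (hu : forall p, O p -> 0 < u p).

Let hu0 : forall p, O p -> u p <> 0 := SP_pos_neq u hu.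

Lemma vel_SP g z : vel u g z -> SP g.
Proof.
  intros [Hz [_ H]]. apply SP_ext with (fun p => - partial k (fun q => u q * z q) p).
  - intros p hp. symmetry. auto.
  - sp.
Qed.

Lemma vel_mean g z p : vel u g z -> O p -> mean k g p = 0.
Proof.
  intros [Hz [_ H]] hp. rewrite (mean_ext _ _ p H hp), mean_opp, mean_partial_self; sp. ring.
Qed.

(** [- u z] is a primitive of [g], and its product with [/ u] is [- z]: zero mean of the velocity is
    exactly the normalisation that [Q_unique] asks for. *)
Lemma vel_mQ g z p : vel u g z -> O p -> mQ u g p = - (u p * z p).
Proof.
  intros V hp. assert (Hg := vel_SP g z V). destruct V as [Hz [Hm H]]. unfold mQ.
  assert (HH : SP (fun q => - (u q * z q))) by sp.
  rewrite (Q_unique _ _ (fun y => - (u (upd p k y) * z (upd p k y)))).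
  - now rewrite upd_id.
  - auto.
  - intros y. now apply SP_line.
  - intros y. now apply SP_line.
  - intros y. rewrite H by auto. rewrite <- partial_opp.
    apply (Sm_is_derive n O (fun q => - (u q * z q))); auto. apply HH.
  - change (mean k (fun q => / u q * - (u q * z q)) p = 0).
    rewrite (mean_ext _ (fun q => - z q)); auto.
    + rewrite mean_opp by sp. rewrite Hm; auto. ring.
    + intros q hq. field. auto.
Qed.

Lemma mean_inv_pos p : O p -> 0 < mean k (fun q => / u q) p.
Proof.
  intros hp. apply mean_pos; sp. intros q hq. apply Rinv_0_lt_compat. auto.
Qed.

Let hm0 : forall p, O p -> mean k (fun q => / u q) p <> 0.
Proof. intros p hp. apply Rgt_not_eq. exact (mean_inv_pos p hp). Qed.

(** Since [g] is periodic, the increment of its primitive over one period is constant along the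
    circle; at 0 it equals the mean of [g]. *)
Lemma SP_prim g : SP g -> (forall p, O p -> mean k g p = 0) -> SP (prim k g).
Proof.
  intros [Hg Hp] Hm. split; [now apply Sm_prim |]. intros p hp.
  assert (Hcg := Sm_cont_on n O g Hg).
  assert (K : kconst (fun q => prim k g (upd q k (q k + 1)) - prim k g q)).
  2:{ specialize (K p 0 hp). cbv beta in K.
      rewrite upd_same, upd_upd, Rplus_0_l, <- mean_prim, Hm in K by auto.
      unfold prim at 1 in K. rewrite upd_same, RInt_point in K.
      change zero with 0 in K. lra. }
  assert (D : forall p y, O p -> is_derive (fun h => prim k g (upd p k h)) y (g (upd p k y))).
  { clear p hp. intros p y hp. pose proof (is_derive_prim n k O hc g (upd p k y) Hcg (hc _ _ hp)) as D.
    rewrite upd_same in D. revert D. apply is_derive_ext. intros h. now rewrite upd_upd. }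
  clear p hp. intros p y hp. cbv beta. rewrite upd_upd, upd_same.
  assert (E : forall t, is_derive (fun h => prim k g (upd p k (h + 1)) - prim k g (upd p k h)) t 0).
  { intros t. replace 0 with (1 * g (upd p k (t + 1)) - g (upd p k t)).
    - apply (is_derive_minus (fun h => prim k g (upd p k (h + 1))) (fun h => prim k g (upd p k h))); auto.
      apply (is_derive_comp (fun h => prim k g (upd p k h)) (fun h => h + 1)); auto.
      auto_derive; auto.
    - rewrite <- (Hp (upd p k t)), upd_upd, upd_same by auto. ring. }
  pose proof (derive0_const _ y (p k) E) as K. cbv beta in K. now rewrite upd_id in K.
Qed.

Lemma partial_prim g p : SP g -> O p -> partial k (prim k g) p = g p.
Proof.
  intros [Hg _] hp. apply is_derive_unique. apply is_derive_prim with n O; auto.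
  now apply Sm_cont_on.
Qed.

(** A solution of [g = - (u z)'] has the form [(c - prim k g) / u] with [c] constant along the
    circle, and zero mean forces [c] to be the average of [prim k g] with weight [/ u]. *)
Lemma vel_exists g : SP g -> (forall p, O p -> mean k g p = 0) -> exists z, vel u g z.
Proof.
  intros Hg Hm. set (M := mean k (fun q => / u q)).
  assert (HM : SP M) by (unfold M; sp). assert (HP := SP_prim g Hg Hm).
  set (c := fun p => mean k (fun q => / u q * prim k g q) p / M p).
  assert (Hc : SP c) by (unfold c; sp).
  assert (Kc : kconst c) by (intros p y hp; unfold c, M; now rewrite !mean_upd).
  exists (fun q => (c q - prim k g q) / u q). repeat split.
  - apply (SP_div (fun q => c q - prim k g q)); sp.
  - intros p hp. destruct (SP_div (fun q => c q - prim k g q) u) as [_ E]; sp. exact (E p hp).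
  - intros p hp. rewrite (mean_ext _ (fun q => c q * / u q - / u q * prim k g q));
      [| intros q hq; unfold Rdiv; ring | auto].
    rewrite mean_minus, mean_scal by sp. unfold c. fold M. field. exact (hm0 p hp).
  - intros p hp.
    rewrite (partial_ext _ (fun q => c q - prim k g q)); [| intros q hq; field; auto | auto].
    rewrite partial_minus, partial_prim, (kconst_partial_self c) by sp. ring.
Qed.

(** The velocity can be read off from the variation as [- Q u g / u]. *)
Lemma vel_unique g g' z z' p : vel u g z -> vel u g' z' ->
  (forall q, O q -> g q = g' q) -> O p -> z p = z' p.
Proof.
  intros V V' E hp.
  assert (mQ u g p = mQ u g' p).
  { unfold mQ. f_equal. apply functional_extensionality. auto. }
  rewrite (vel_mQ g z p V hp), (vel_mQ g' z' p V' hp) in H.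
  apply Rmult_eq_reg_l with (u p); auto. lra.
Qed.

Lemma vel_minus g g' z z' : vel u g z -> vel u g' z' ->
  vel u (fun q => g q - g' q) (fun q => z q - z' q).
Proof.
  intros [H1 [H2 H3]] [H1' [H2' H3']]. repeat split.
  - apply (SP_minus z z'); auto.
  - apply (SP_minus z z'); auto.
  - intros p hp. rewrite mean_minus, H2, H2'; auto. ring.
  - intros p hp. rewrite H3, H3' by auto. dd; sp. ring.
Qed.

(** The right-hand side is [(u v z)'] written out, so that [mD] subtracts the second derivative
    [(u v z)''] from [g_j]. *)
Lemma mU_vel f g v z p : vel u f v -> vel u g z -> O p ->
  mU u f g p = partial k u p * (v p * z p)
               + u p * (partial k v p * z p + v p * partial k z p).
Proof.
  intros Vf Vg hp. unfold mU, U.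
  fold (mQ u f p). fold (mQ u g p). change (Derive (fun y => u (upd p k y)) (p k)) with (partial k u p).
  rewrite !upd_id, (vel_mQ f v p Vf hp), (vel_mQ g z p Vg hp).
  destruct Vf as [Hv [_ Ef]], Vg as [Hz [_ Eg]]. rewrite Ef, Eg by auto. dd; sp. field. auto.
Qed.

Lemma mU_sym f g p : mU u f g p = mU u g f p.
Proof. unfold mU, U, Rdiv. ring. Qed.

(** The material derivative of [z] along [v], normalised to zero mean. *)
Definition mdot (j : nat) (v z : vec -> R) : vec -> R := fun p =>
  partial j z p + v p * partial k z p
  - mean k (fun q => v q * partial k z q) p / mean k (fun q => / u q) p / u p.

(** Since [u_j = - (u v)'], the terms [(u v)' z] cancel in [g_j - (u v z)''], which leaves
    [- (u (z_j + v z'))']. The last term of [mdot] becomes constant along the circle after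
    multiplication by [u], so it does not affect this equation and is free to restore the zero mean;
    [z_j] has zero mean already. *)
Lemma vel_mD j g v z : (j < n)%nat -> j <> k ->
  vel u (partial j u) v -> vel u g z -> vel u (mD j u g) (mdot j v z).
Proof.
  intros hj hjk Vf Vg.
  pose proof Vf as [Hv [Ev Ef]]. pose proof Vg as [Hz [Ez Eg]].
  set (M := mean k (fun q => / u q)).
  set (c := fun p => mean k (fun q => v q * partial k z q) p / M p).
  assert (HM : SP M) by (unfold M; sp).
  assert (Hc : SP c) by (unfold c; sp).
  assert (Kc : kconst c) by (intros p y hp; unfold c, M; now rewrite !mean_upd).
  assert (Hd : SP (mdot j v z)).
  { change (SP (fun p => partial j z p + v p * partial k z p - c p / u p)). sp. }
  split; [exact Hd |]. split.
  - intros p hp.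
    rewrite (mean_ext (mdot j v z)
      (fun p => partial j z p + v p * partial k z p - c p * / u p)); auto.
    rewrite mean_minus, mean_plus, (mean_scal c) by sp.
    rewrite <- SP_partial_mean by sp. rewrite (partial_ext (mean k z) (fun _ => 0)) by auto.
    rewrite partial_const. unfold c. fold M. field. exact (hm0 p hp).
  - intros p hp. unfold mD.
    rewrite (partial_ext (mU u (partial j u) g) (fun p => partial k u p * (v p * z p)
       + u p * (partial k v p * z p + v p * partial k z p)))
      by (auto using mU_vel).
    rewrite (partial_ext g (fun p => - partial k (fun q => u q * z q) p)) by auto.
    rewrite partial_opp, partial_swap by sp.
    rewrite (partial_ext (partial j (fun q => u q * z q))
       (fun p => (- (partial k u p * v p + u p * partial k v p)) * z p + u p * partial j z p)); auto.
    2:{ intros q hq. rewrite partial_mult by sp. rewrite Ef by auto. dd; sp. ring. }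
    rewrite (partial_ext (fun q => u q * mdot j v z q)
       (fun q => u q * (partial j z q + v q * partial k z q) - c q)); auto.
    2:{ intros q hq. unfold mdot, c, M. field. auto. }
    dd; sp. rewrite (kconst_partial_self c p) by auto. ring.
Qed.

End Density.

(** * Metric, curvature, flow energy and volume in terms of velocities *)

Definition mG (u g h : vec -> R) (p : vec) : R :=
  RInt (fun x => / u (upd p k x) * Q (fun y => u (upd p k y)) (fun y => g (upd p k y)) x
                 * Q (fun y => u (upd p k y)) (fun y => h (upd p k y)) x) 0 1.

Section Dynamics.

Context (u : vec -> R) (Hu : SP u) (hu : forall p, O p -> 0 < u p).

Let hu0 : forall p, O p -> u p <> 0 := SP_pos_neq u hu.

Lemma mQ_upd g p x : O p ->
  Q (fun y => u (upd p k y)) (fun y => g (upd p k y)) x = mQ u g (upd p k x).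
Proof.
  intros hp. unfold mQ. rewrite upd_same.
  f_equal; apply functional_extensionality; intros y; now rewrite upd_upd.
Qed.

Lemma mG_vel g h z w p : vel u g z -> vel u h w -> O p ->
  mG u g h p = mean k (fun q => u q * z q * w q) p.
Proof.
  intros V W hp. apply RInt_Rext. intros x.
  rewrite !mQ_upd, (vel_mQ u Hu hu g z), (vel_mQ u Hu hu h w) by auto.
  field. auto.
Qed.

Lemma mG_SP g h z w : vel u g z -> vel u h w -> SP (mG u g h).
Proof.
  intros V W. apply SP_ext with (mean k (fun q => u q * z q * w q)).
  - intros p hp. symmetry. now apply mG_vel.
  - destruct V as [V _], W as [W _]. sp.
Qed.

(** The multiple of [/ u] that normalises a velocity is orthogonal to velocities. *)
Lemma mean_drop c A w p : kconst c -> SP c -> SP A -> SP w ->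
  (forall q, O q -> mean k w q = 0) -> O p ->
  mean k (fun q => u q * (A q - c q / u q) * w q) p = mean k (fun q => u q * A q * w q) p.
Proof.
  intros Kc Hc HA Hw Ew hp.
  rewrite (mean_ext _ (fun q => u q * A q * w q - c q * w q)); auto.
  - rewrite mean_minus, (mean_scal c), Ew by sp. ring.
  - intros q hq. field. auto.
Qed.

(** The constant [mu] in the normalisation of [mdot]. *)
Let coefD (v z : vec -> R) : vec -> R := fun p =>
  mean k (fun q => v q * partial k z q) p / mean k (fun q => / u q) p.

Let hm0 : forall p, O p -> mean k (fun q => / u q) p <> 0.
Proof. intros p hp. apply Rgt_not_eq. now apply (mean_inv_pos u). Qed.

Let coefD_K v z : kconst (coefD v z).
Proof. intros p y hp. unfold coefD. now rewrite !mean_upd. Qed.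

Let coefD_SP v z : SP v -> SP z -> SP (coefD v z).
Proof. intros Hv Hz. unfold coefD. sp. Qed.

Lemma compat_vel j g h v z w p : (j < n)%nat -> j <> k -> O p ->
  vel u (partial j u) v -> vel u g z -> vel u h w ->
  partial j (mG u g h) p = mG u (mD j u g) h p + mG u g (mD j u h) p.
Proof.
  intros hj hjk hp Vu V W.
  assert (V' := vel_mD u Hu hu j g v z hj hjk Vu V).
  assert (W' := vel_mD u Hu hu j h v w hj hjk Vu W).
  rewrite (partial_ext _ _ j p (fun q hq => mG_vel g h z w q V W hq) hp).
  rewrite (mG_vel _ _ _ _ p V' W hp), (mG_vel _ _ _ _ p V W' hp).
  destruct Vu as [Hv [Ev Eu]], V as [Hz [Ez _]], W as [Hw [Ew _]].
  rewrite SP_partial_mean by sp.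
  assert (K1 := coefD_K v z). assert (K2 := coefD_K v w).
  assert (C1 := coefD_SP v z Hv Hz). assert (C2 := coefD_SP v w Hv Hw).
  rewrite (mean_drop (coefD v z) (fun p => partial j z p + v p * partial k z p) w) by sp.
  rewrite (mean_ext (fun q => u q * z q * mdot u j v w q)
    (fun q => u q * (partial j w q + v q * partial k w q - coefD v w q / u q) * z q)); auto.
  2:{ intros q hq. unfold mdot, coefD. ring. }
  rewrite (mean_drop (coefD v w) (fun p => partial j w p + v p * partial k w p) z) by sp.
  rewrite <- mean_plus by sp.
  (* With [u_j = - (u v)'], the two integrands differ by [- (u v z w)']. *)
  apply (mean_eq_exact _ _ (fun q => - (u q * v q * z q * w q))); sp.
  intros q hq. dd; sp. rewrite (Eu q hq). dd; sp. ring.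
Qed.

Lemma mD_torsion i j p : (i < n)%nat -> (j < n)%nat -> i <> j -> O p ->
  mD i u (partial j u) p = mD j u (partial i u) p.
Proof.
  intros hi hj hij hp. unfold mD. rewrite partial_swap by auto.
  now rewrite (partial_ext (mU u (partial i u) (partial j u)) _ k p (fun q _ => mU_sym u _ _ q) hp).
Qed.

(** Up to constants over [u], the commutator of the covariant derivatives on [w] is
    [w' (w_i + v w' - v_j - w v')] plus the material derivative along [w] of [m / u]. Absence of
    torsion turns the first bracket into [2 m / u]; the continuity equation for [w] turns the second
    term into [m w' / u]. Pairing [3 m w' / u] with [u v] gives [3 m] times the mean of [v w'], and
    [m] is that mean divided by the mean of [/ u]. *)
Lemma curvature_vel i j v w p : (i < n)%nat -> (j < n)%nat -> i <> k -> j <> k -> i <> j -> O p ->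
  vel u (partial i u) v -> vel u (partial j u) w ->
  mG u (fun q => mD i u (mD j u (partial j u)) q - mD j u (mD i u (partial j u)) q) (partial i u) p
  = 3 * mean k (fun q => v q * partial k w q) p ^ 2 / mean k (fun q => / u q) p.
Proof.
  intros hi hj hik hjk hij hp V W.
  assert (A2 := vel_mD u Hu hu j _ w w hj hjk W W).
  assert (A1 := vel_mD u Hu hu i _ v w hi hik V W).
  assert (A3 := vel_mD u Hu hu j _ w v hj hjk W V).
  assert (B2 := vel_mD u Hu hu i _ v _ hi hik V A2).
  assert (B1 := vel_mD u Hu hu j _ w _ hj hjk W A1).
  assert (C := vel_minus u Hu _ _ _ _ B2 B1).
  rewrite (mG_vel _ _ _ _ p C V hp).
  pose proof V as [Hv [Ev Eu]]. pose proof W as [Hw [Ew Eu']].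
  (* Absence of torsion, transferred to velocities by their uniqueness. *)
  assert (T : forall q, O q -> mdot u i v w q = mdot u j w v q).
  { intros q hq. refine (vel_unique u Hu hu _ _ _ _ q A1 A3 _ hq).
    intros q' hq'. exact (mD_torsion i j q' hi hj hij hq'). }
  assert (Hm := coefD_SP v w Hv Hw). assert (Km := coefD_K v w).
  remember (coefD v w) as m eqn:Em.
  (* [w w'] is the derivative of [w^2 / 2], so [mdot u j w w] needs no normalisation. *)
  assert (sww : forall q, O q -> mean k (fun q => w q * partial k w q) q = 0).
  { intros q hq. rewrite (mean_ext _ (partial k (fun q => / 2 * (w q * w q)))); auto.
    - apply mean_partial_self; sp.
    - intros q' hq'. dd; sp. field. }
  (* [v w' + w v'] is exact, so exchanging the velocities changes the sign of the constant. *)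
  assert (swv : forall q, O q -> coefD w v q = - m q).
  { intros q hq. rewrite Em. unfold coefD.
    rewrite (mean_eq_exact (fun q => w q * partial k v q) (fun q => - (v q * partial k w q))
       (fun q => v q * w q)); sp.
    - rewrite mean_opp by sp. field. exact (hm0 q hq).
    - intros q' hq'. dd; sp. ring. }
  set (a2 := fun q => partial j w q + w q * partial k w q).
  set (a1 := fun q => partial i w q + v q * partial k w q - m q / u q).
  assert (Ha1 : SP a1) by (unfold a1; sp). assert (Ha2 : SP a2) by (unfold a2; sp).
  assert (E1 : forall q, O q -> mdot u i v w q = a1 q) by (intros; unfold a1; now rewrite Em).
  assert (E2 : forall q, O q -> mdot u j w w q = a2 q).
  { intros q hq. unfold mdot, a2. rewrite sww by auto. unfold Rdiv. ring. }
  assert (Hc2 := coefD_SP v _ Hv (proj1 A2)). assert (Kc2 := coefD_K v (mdot u j w w)).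
  assert (Hc1 := coefD_SP w _ Hw (proj1 A1)). assert (Kc1 := coefD_K w (mdot u i v w)).
  remember (coefD v (mdot u j w w)) as c2 eqn:E_c2.
  remember (coefD w (mdot u i v w)) as c1 eqn:E_c1.
  (* Collects every coefficient of [/ u] that is constant along the circle; their contribution pairs
     to zero with [v]. *)
  set (c := fun q => partial j m q - c2 q + c1 q).
  assert (Hc : SP c) by (unfold c; sp).
  assert (Kc : kconst c).
  { intros q y hq. unfold c. rewrite (kconst_partial m j q Km hjk hq y).
    now rewrite Kc2, Kc1. }
  rewrite (mean_ext _ (fun q => 3 * m q * (v q * partial k w q) + c q * v q)); auto.
  - rewrite mean_plus, (mean_scal (fun q => 3 * m q)), (mean_scal c), Ev by
      (solve [sp | intros q y hq; now rewrite Km]).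
    rewrite Em. unfold coefD. field. exact (hm0 p hp).
  - intros q hq.
    assert (T' := T q hq). unfold mdot in T'.
    fold (coefD v w q) in T'. fold (coefD w v q) in T'.
    rewrite <- Em, swv in T' by auto.
    unfold mdot at 1 3. fold (coefD v (mdot u j w w) q). fold (coefD w (mdot u i v w) q).
    rewrite <- E_c2, <- E_c1.
    rewrite !(partial_ext (mdot u j w w) a2) by auto.
    rewrite !(partial_ext (mdot u i v w) a1) by auto.
    unfold a1, a2, c. dd; sp.
    assert (hki := not_eq_sym hik). assert (hkj := not_eq_sym hjk). assert (hji := not_eq_sym hij).
    rewrite (partial_swap w j i), (partial_swap w k i), (partial_swap w k j) by sp.
    rewrite (kconst_partial_self m q Km hq), (Eu' q hq). dd; sp.
    (* [T'] solved for [partial i w]; the two constants of opposite sign add up to [2 m / u]. *)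
    assert (T2 : partial i w q = partial j v q + w q * partial k v q - v q * partial k w q
                   + 2 * m q / u q) by (revert T'; unfold Rdiv; intros; lra).
    rewrite T2. field. auto.
Qed.

(** Here [i] is the time and [j] the parameter of the family; write [P] for [chi''(u)]. As [P u' u]
    is the [k]-derivative of a function of [u], its variation in [j] is [(P u u_j)']. Hence
    [(u z)_i] and [(P u u_j)'] differ by a constant along the circle, which pairs to zero with [z].
    The rest integrates by parts to [2 P (u z')^2], and concavity gives the sign. *)
Lemma energy_flow_nonpos chi i j z p : (i < n)%nat -> (j < n)%nat -> i <> k -> j <> k -> i <> j -> O p ->
  smooth1 (fun x => 0 < x) chi -> (forall x, 0 < x -> Derive_n chi 2 x <= 0) ->
  vel u (partial j u) z ->
  (forall q, O q -> partial i u q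
     = - partial k (fun q => Derive_n chi 2 (u q) * partial k u q * u q) q) ->
  partial i (mG u (partial j u) (partial j u)) p <= 0.
Proof.
  intros hi hj hik hjk hij hp Hchi Hneg V Hfl.
  assert (hki := not_eq_sym hik). assert (hkj := not_eq_sym hjk).
  rewrite (partial_ext _ _ i p (fun q hq => mG_vel _ _ z z q V V hq) hp).
  destruct V as [Hz [Ez Ef]].
  rewrite SP_partial_mean by sp.
  set (P := fun q => Derive_n chi 2 (u q)).
  assert (HP : SP P) by now apply SP_comp with (fun x => 0 < x).
  set (P3 := fun q => Derive_n chi 3 (u q)).
  assert (HP3 : SP P3) by now apply SP_comp with (fun x => 0 < x).
  assert (DP : forall l q, (l < n)%nat -> O q -> partial l P q = P3 q * partial l u q).
  { intros l q hl hq. now apply partial_comp with (P := fun x => 0 < x). }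
  change (forall q, O q -> partial i u q = - partial k (fun q => P q * partial k u q * u q) q) in Hfl.
  set (c := fun q => partial i (fun q => u q * z q) q
                     - partial k (fun q => P q * u q * partial j u q) q).
  assert (Hc : SP c) by (unfold c; sp).
  assert (Kc : kconst c).
  { apply partial_self_kconst; auto. intros q hq. unfold c.
    rewrite partial_minus by sp. rewrite (partial_swap (fun q => u q * z q)) by sp.
    rewrite (partial_ext (partial k (fun q => u q * z q)) (fun q => - partial j u q));
      [| intros q' hq'; rewrite Ef by auto; ring | auto].
    rewrite partial_opp, (partial_swap u i j) by sp.
    rewrite (partial_ext (partial i u)
      (fun q => - partial k (fun q => P q * partial k u q * u q) q)) by auto.
    rewrite partial_opp, (partial_swap _ j k) by sp.
    rewrite (partial_ext (partial j (fun q => P q * partial k u q * u q))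
               (partial k (fun q => P q * u q * partial j u q))); auto; [ring |].
    intros q' hq'. dd; sp. rewrite !DP, (partial_swap u j k) by sp. ring. }
  (* The last function holds the boundary terms of integrating [2 (P u u_j)' z] and [(P u u')' z^2]
     by parts. *)
  rewrite (mean_eq_exact (partial i (fun q => u q * z q * z q))
    (fun q => 2 * (P q * (u q * partial k z q * (u q * partial k z q))) + 2 * c q * z q)
    (fun q => 2 * (P q * u q * partial j u q * z q) + P q * partial k u q * u q * z q * z q)); sp.
  - rewrite mean_plus, (mean_scal (fun q => 2 * c q)), Ez, (mean_scal (fun _ => 2)) by
      (solve [sp | intros q y hq; now rewrite ?Kc]).
    rewrite (mean_ext _ (fun q => - (- P q * (u q * partial k z q * (u q * partial k z q)))));
      [| intros; ring | auto].
    rewrite mean_opp by sp.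
    enough (0 <= mean k (fun q => - P q * (u q * partial k z q * (u q * partial k z q))) p) by lra.
    apply mean_nonneg; sp. intros q hq. apply Rmult_le_pos.
    + specialize (Hneg (u q) (hu q hq)). unfold P. lra.
    + apply Rle_0_sqr.
  - intros q hq. unfold c. dd; sp. rewrite (Hfl q hq), (Ef q hq).
    dd; sp. ring.
Qed.

Lemma volume_partial chi j p : (j < n)%nat -> j <> k -> O p ->
  smooth1 (fun x => 0 < x) chi ->
  partial j (mean k (fun q => chi (u q))) p = mean k (fun q => Derive_n chi 1 (u q) * partial j u q) p.
Proof.
  intros hj hjk hp Hchi. assert (SP (fun q => chi (u q))) by now apply (SP_comp u (fun x => 0 < x) chi 0).
  rewrite SP_partial_mean by sp. apply mean_ext; auto. intros q hq.
  now apply (partial_comp u (fun x => 0 < x) chi 0).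
Qed.

(** In velocities the geodesic equation reads [u_jj = (u z^2)'']. Moving one derivative onto
    [chi'(u)] leaves [chi''(u) (u_j^2 - u' (u z^2)')], and with [u_j = - (u z)'] the bracket is the
    square of [u z']. *)
Lemma volume_partial2 chi j z p : (j < n)%nat -> j <> k -> O p ->
  smooth1 (fun x => 0 < x) chi -> vel u (partial j u) z ->
  (forall q, O q -> partial j (partial j u) q = partial k (mU u (partial j u) (partial j u)) q) ->
  partial j (mean k (fun q => Derive_n chi 1 (u q) * partial j u q)) p
  = mean k (fun q => Derive_n chi 2 (u q)
                     * (partial j u q - partial k u q * mQ u (partial j u) q / u q) ^ 2) p.
Proof.
  intros hj hjk hp Hchi V Hgeo.
  assert (HP : forall m, SP (fun q => Derive_n chi m (u q)))
    by (intros m; now apply SP_comp with (fun x => 0 < x)).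
  set (P1 := fun q => Derive_n chi 1 (u q)). set (P2 := fun q => Derive_n chi 2 (u q)).
  change (partial j (mean k (fun q => P1 q * partial j u q)) p
    = mean k (fun q => P2 q * (partial j u q - partial k u q * mQ u (partial j u) q / u q) ^ 2) p).
  assert (HP1 : SP P1) by apply HP. assert (HP2 : SP P2) by apply HP.
  assert (D1 : forall l q, (l < n)%nat -> O q -> partial l P1 q = P2 q * partial l u q)
    by (intros l q hl hq; now apply (partial_comp u (fun x => 0 < x) chi 1)).
  pose proof V as [Hz [Ez Ef]].
  set (W := fun q => partial k u q * (z q * z q) + u q * (partial k z q * z q + z q * partial k z q)).
  assert (HW : SP W) by (unfold W; sp).
  assert (EW : forall q, O q -> mU u (partial j u) (partial j u) q = W q)
    by (intros q hq; now apply mU_vel).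
  rewrite (mean_ext (fun q => P2 q * _ ^ 2)
    (fun q => P2 q * (u q * partial k z q * (u q * partial k z q)))); auto.
  2:{ intros q hq. rewrite (vel_mQ u Hu hu _ z q V hq), (Ef q hq). dd; sp. field. auto. }
  rewrite SP_partial_mean by sp.
  apply (mean_eq_exact _ _ (fun q => P1 q * W q)); sp.
  intros q hq. dd; sp. rewrite (Hgeo q hq), (partial_ext _ W k q EW hq), !D1, (Ef q hq) by auto.
  unfold W at 2. dd; sp. ring.
Qed.

End Dynamics.

End Periodic.

(** * Coefficients of triples *)

Lemma Q_lin u f g a b x :
  (forall y, 0 < u y) -> (forall y, continuous u y) -> (forall y, continuous f y) ->
  (forall y, continuous g y) ->
  Q u (fun y => a * f y + b * g y) x = a * Q u f x + b * Q u g x.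
Proof.
  intros hu cu cf cg.
  assert (cp : forall h, (forall y, continuous h y) -> forall y, continuous (fun y => / u y * RInt h 0 y) y).
  { intros h ch y. apply (continuous_mult (fun y => / u y) (fun y => RInt h 0 y)).
    - apply continuous_Rinv_comp; auto. apply Rgt_not_eq, hu.
    - apply (ex_derive_continuous (fun y => RInt h 0 y)). exists (h y).
      apply (is_derive_RInt h _ 0); auto. apply filter_forall. intros z.
      apply (RInt_correct h). now apply ex_RInt_Rcont. }
  assert (E : forall y, RInt (fun y => a * f y + b * g y) 0 y = a * RInt f 0 y + b * RInt g 0 y).
  { intros y. rewrite RInt_Rplus, !RInt_Rscal; auto; try now apply ex_RInt_Rcont.
    - apply (ex_RInt_scal (V := R_NormedModule)). now apply ex_RInt_Rcont.
    - apply (ex_RInt_scal (V := R_NormedModule)). now apply ex_RInt_Rcont. }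
  unfold Q. rewrite E.
  rewrite (RInt_Rext (fun y => / u y * RInt (fun y => a * f y + b * g y) 0 y)
    (fun y => a * (/ u y * RInt f 0 y) + b * (/ u y * RInt g 0 y)))
    by (intros y; rewrite E; ring).
  rewrite RInt_Rplus, !RInt_Rscal.
  - ring.
  - apply ex_RInt_Rcont. auto.
  - apply ex_RInt_Rcont. auto.
  - apply (ex_RInt_scal (V := R_NormedModule)). apply ex_RInt_Rcont. auto.
  - apply (ex_RInt_scal (V := R_NormedModule)). apply ex_RInt_Rcont. auto.
Qed.

Lemma U_lin u f g h a b x :
  (forall y, 0 < u y) -> (forall y, continuous u y) -> (forall y, continuous g y) ->
  (forall y, continuous h y) ->
  U u f (fun y => a * g y + b * h y) x = a * U u f g x + b * U u f h x.
Proof. intros hu cu cg ch. unfold U. rewrite Q_lin by auto. unfold Rdiv. ring. Qed.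

Lemma U_sym u f g x : U u f g x = U u g f x.
Proof. unfold U, Rdiv. ring. Qed.

Lemma Utilde_U u f : Utilde u f = U u f f.
Proof. apply functional_extensionality. intros x. unfold Utilde, U, Rdiv. ring. Qed.

Lemma eta_basis i :
  eta i (std_basis (3 + idx_num i)) (std_basis 0) (std_basis (idx_num i)) = 1.
Proof. destruct i; cbv -[Rplus Rmult Rminus Ropp IZR]; ring. Qed.

Lemma phiK_basis i :
  phiK (std_basis (3 + idx_num i)) (std_basis 0) (std_basis (idx_num i)) = -1.
Proof. destruct i; cbv -[Rplus Rmult Rminus Ropp IZR]; ring. Qed.

Lemma coef_ext X Y i : teq X Y -> coef X i = coef Y i.
Proof. intros H. apply functional_extensionality. intros x. unfold coef. now rewrite H. Qed.

(** The form of a tangent vector, without the regularity of its coefficients. *)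
Definition shape (X : triple) : Prop :=
  teq X (fun i p v1 v2 v3 => - (coef X i (p 0%nat) * eta i v1 v2 v3)).

Lemma T3_spec X : T3 X -> (forall i, C0inf (coef X i)) /\ shape X.
Proof.
  intros [f [Hf E]].
  assert (C : forall i, coef X i = f i).
  { intros i. apply functional_extensionality. intros x. unfold coef.
    rewrite E, eta_basis. unfold upd; simpl. ring. }
  split.
  - intros i. now rewrite C.
  - intros i p v1 v2 v3. now rewrite E, C.
Qed.

Lemma T3_intro X : shape X -> (forall i, C0inf (coef X i)) -> T3 X.
Proof. intros HX HC. exists (coef X). auto. Qed.

Lemma M3_spec phi : M3 phi -> forall i,
  smooth_S1 (coef phi i) /\ (forall x, 0 < coef phi i x) /\ RInt (coef phi i) 0 1 = 1
  /\ forall p v1 v2 v3, phi i p v1 v2 v3 = phiK v1 v2 v3 - (coef phi i (p 0%nat) - 1) * eta i v1 v2 v3.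
Proof.
  intros [_ [u [Hu E]]] i.
  assert (C : coef phi i = u i).
  { apply functional_extensionality. intros x. unfold coef.
    rewrite E, eta_basis, phiK_basis. unfold upd; simpl. ring. }
  rewrite C. destruct (Hu i) as [H1 [H2 H3]]. repeat split; auto; apply H1.
Qed.

Lemma shape_eq X Y : shape X -> shape Y -> (forall i x, coef X i x = coef Y i x) -> teq X Y.
Proof. intros HX HY H i p v1 v2 v3. now rewrite HX, HY, H. Qed.

Lemma coef_tadd X Y i x : coef (tadd X Y) i x = coef X i x + coef Y i x.
Proof. unfold coef, tadd. ring. Qed.

Lemma coef_tscale c X i x : coef (tscale c X) i x = c * coef X i x.
Proof. unfold coef, tscale. ring. Qed.

Lemma shape_tadd X Y : shape X -> shape Y -> shape (tadd X Y).
Proof.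
  intros HX HY i p v1 v2 v3. rewrite coef_tadd. unfold tadd. rewrite HX, HY. ring.
Qed.

Lemma shape_tscale c X : shape X -> shape (tscale c X).
Proof. intros HX i p v1 v2 v3. rewrite coef_tscale. unfold tscale. rewrite HX. ring. Qed.

Lemma coef_dcurve Y t i : coef (dcurve Y t) i = fun x => Derive (fun tau => coef (Y tau) i x) t.
Proof.
  apply functional_extensionality. intros x. unfold coef, dcurve. now rewrite Derive_opp.
Qed.

Lemma shape_dcurve Y t : locally t (fun tau => shape (Y tau)) -> shape (dcurve Y t).
Proof.
  intros H i p v1 v2 v3. rewrite coef_dcurve, <- Derive_scal_l, <- Derive_opp.
  apply Derive_ext_loc. apply filter_imp with (2 := H). intros tau Ht. apply Ht.
Qed.

(** Differentiation removes the constant [phiK] and so turns the affine form of points into the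
    linear form of tangent vectors. *)
Lemma shape_dcurve_M3 Phi t : locally t (fun tau => M3 (Phi tau)) ->
  (forall i x, ex_derive (fun tau => coef (Phi tau) i x) t) -> shape (dcurve Phi t).
Proof.
  intros H D i p v1 v2 v3. rewrite coef_dcurve.
  apply is_derive_unique.
  apply (is_derive_ext_loc (fun tau => phiK v1 v2 v3 - (coef (Phi tau) i (p 0%nat) - 1) * eta i v1 v2 v3)).
  - apply filter_imp with (2 := H). intros tau Ht. symmetry. apply M3_spec, Ht.
  - assert (L : forall (c : R -> R) a e, ex_derive c t ->
      is_derive (fun tau => a - (c tau - 1) * e) t (- (Derive c t * e))).
    { intros c a e hc. auto_derive; auto. change (Derive (fun x => c x) t) with (Derive c t). ring. }
    apply (L (fun tau => coef (Phi tau) i (p 0%nat))). apply D.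
Qed.

Lemma coef_covD Phi Y t i : coef (covD Phi Y t) i = fun x =>
  Derive (fun tau => coef (Y tau) i x) t
  - Derive (U (coef (Phi t) i) (fun y => Derive (fun tau => coef (Phi tau) i y) t) (coef (Y t) i)) x.
Proof.
  apply functional_extensionality. intros x. unfold coef at 1, covD.
  rewrite eta_basis, (coef_dcurve Phi). fold (coef (dcurve Y t) i x).
  assert (E := f_equal (fun f => f x) (coef_dcurve Y t i)). cbv beta in E. rewrite <- E.
  unfold coef at 4. unfold upd; simpl. ring.
Qed.

Lemma shape_covD Phi Y t : shape (dcurve Y t) -> shape (covD Phi Y t).
Proof.
  intros H i p v1 v2 v3.
  rewrite coef_covD. unfold covD. rewrite H, !coef_dcurve. ring.
Qed.

Lemma covD_ext Phi Phi' Y Y' t :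
  locally t (fun tau => teq (Phi tau) (Phi' tau) /\ teq (Y tau) (Y' tau)) ->
  teq (covD Phi Y t) (covD Phi' Y' t).
Proof.
  intros H i p v1 v2 v3.
  destruct (locally_singleton _ _ H) as [H1 H2].
  assert (E : teq (dcurve Phi t) (dcurve Phi' t)).
  { intros i' p' v1' v2' v3'. apply Derive_ext_loc. apply filter_imp with (2 := H).
    intros tau [h _]. apply h. }
  unfold covD. rewrite (coef_ext _ _ i E), (coef_ext _ _ i H1), (coef_ext _ _ i H2).
  f_equal. apply Derive_ext_loc. apply filter_imp with (2 := H). intros tau [_ h]. apply h.
Qed.

(** Coordinate 0 is the parameter and coordinate 1 the circle; in [cf3] the parameters are
    coordinates 0 and 1 and the circle is coordinate 2. *)
Definition cf2 (Y : curve) (i : idx) : vec -> R := fun p => coef (Y (p 0%nat)) i (p 1%nat).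

Definition cf3 (Y : family2) (i : idx) : vec -> R :=
  fun p => coef (Y (p 0%nat) (p 1%nat)) i (p 2%nat).

Lemma cf2_covD Phi Y i : cf2 (covD Phi Y) i = mD 1 0 (cf2 Phi i) (cf2 Y i).
Proof. apply functional_extensionality. intros p. unfold cf2 at 1. now rewrite coef_covD. Qed.

Lemma cf3_D1 Phi Y i : cf3 (D1 covD Phi Y) i = mD 2 0 (cf3 Phi i) (cf3 Y i).
Proof. apply functional_extensionality. intros p. unfold cf3 at 1, D1. now rewrite coef_covD. Qed.

Lemma cf3_D2 Phi Y i : cf3 (D2 covD Phi Y) i = mD 2 1 (cf3 Phi i) (cf3 Y i).
Proof. apply functional_extensionality. intros p. unfold cf3 at 1, D2. now rewrite coef_covD. Qed.

Lemma cf2_dcurve Phi i : cf2 (dcurve Phi) i = partial 0 (cf2 Phi i).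
Proof. apply functional_extensionality. intros p. unfold cf2 at 1. now rewrite coef_dcurve. Qed.

Lemma cf3_d1 Phi i : cf3 (d1 Phi) i = partial 0 (cf3 Phi i).
Proof. apply functional_extensionality. intros p. unfold cf3 at 1, d1. now rewrite coef_dcurve. Qed.

Lemma cf3_d2 Phi i : cf3 (d2 Phi) i = partial 1 (cf3 Phi i).
Proof. apply functional_extensionality. intros p. unfold cf3 at 1, d2. now rewrite coef_dcurve. Qed.

(** * The Levi-Civita connection *)

Lemma sum3_ext F G : (forall i, F i = G i) -> sum3 F = sum3 G.
Proof. intros H. unfold sum3. now rewrite !H. Qed.

Lemma sum3_plus F G : sum3 (fun i => F i + G i) = sum3 F + sum3 G.
Proof. unfold sum3. ring. Qed.

Lemma is_derive_sum3 (F : idx -> R -> R) G t : (forall i, is_derive (F i) t (G i)) ->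
  is_derive (fun tau => sum3 (fun i => F i tau)) t (sum3 G).
Proof.
  intros H. unfold sum3.
  apply (is_derive_plus (fun tau => F i1 tau + F i2 tau) (F i3)); auto.
  apply (is_derive_plus (F i1) (F i2)); auto.
Qed.

Definition dom2 (I : R -> Prop) : vec -> Prop := fun p => I (p 0%nat).
Definition dom3 (W : R -> R -> Prop) : vec -> Prop := fun p => W (p 0%nat) (p 1%nat).

Lemma dom2_open I : open I -> open_n 2 (dom2 I).
Proof.
  intros HI p hp. destruct (HI _ hp) as [d hd]. exists d. split; [apply cond_pos |].
  intros q hq. apply hd. exact (hq 0%nat ltac:(lia)).
Qed.

Lemma dom3_open W : open2 W -> open_n 3 (dom3 W).
Proof.
  intros HW p hp. destruct (HW (p 0%nat, p 1%nat) hp) as [d hd].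
  exists d. split; [apply cond_pos |].
  intros q hq. apply (hd (q 0%nat, q 1%nat)).
  split; [exact (hq 0%nat ltac:(lia)) | exact (hq 1%nat ltac:(lia))].
Qed.

Lemma open2_1 W s t : open2 W -> W s t -> locally s (fun sg => W sg t).
Proof.
  intros HW hp. destruct (HW (s, t) hp) as [d hd]. exists d. intros sg h.
  apply (hd (sg, t)). split; [exact h | apply ball_center].
Qed.

Lemma open2_2 W s t : open2 W -> W s t -> locally t (fun tau => W s tau).
Proof.
  intros HW hp. destruct (HW (s, t) hp) as [d hd]. exists d. intros tau h.
  apply (hd (s, tau)). split; [apply ball_center | exact h].
Qed.

(** * Densities and variations along curves and families *)

Section Variations.

Context (n k : nat) (O : vec -> Prop) (hk : (k < n)%nat) (hO : open_n n O)
  (hc : forall p y, O p -> O (upd p k y)).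

(** [density] and [variation] are what membership in [M3] and [T3] means for a single coefficient
    with parameters. *)
Definition density (u : vec -> R) : Prop :=
  SP n k O u /\ (forall p, O p -> 0 < u p) /\ forall p, O p -> mean k u p = 1.

Definition variation (g : vec -> R) : Prop :=
  SP n k O g /\ forall p, O p -> mean k g p = 0.

Lemma variation_partial u j : (j < n)%nat -> j <> k -> density u -> variation (partial j u).
Proof.
  intros hj hjk [Hu [_ Hm]]. split; [now apply SP_partial |]. intros p hp.
  rewrite <- (SP_partial_mean n k O) by auto.
  rewrite (partial_ext n O hO _ (fun _ => 1)) by auto. apply partial_const.
Qed.

Lemma variation_vel u g : density u -> variation g -> exists z, vel n k O u g z.
Proof. intros [Hu [hu _]] [Hg Hm]. now apply vel_exists. Qed.

Lemma vel_variation u g z : density u -> vel n k O u g z -> variation g.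
Proof.
  intros [Hu [hu _]] V. split; [now apply vel_SP with u z |]. intros p hp.
  now apply (vel_mean n k O hk hO hc u Hu g z p).
Qed.

(** The covariant derivative has a velocity, namely [mdot], and whatever has a velocity is smooth,
    periodic and of zero mean. *)
Lemma variation_mD u g j : (j < n)%nat -> j <> k -> density u -> variation g ->
  variation (mD k j u g).
Proof.
  intros hj hjk Hd Hg.
  destruct (variation_vel u _ Hd (variation_partial u j hj hjk Hd)) as [v V].
  destruct (variation_vel u g Hd Hg) as [z Z].
  apply vel_variation with u (mdot k u j v z); auto. destruct Hd as [Hu [hu _]].
  now apply vel_mD.
Qed.

Lemma variation_C0inf g p : variation g -> O p -> C0inf (fun y => g (upd p k y)).
Proof. intros [Hg Hm] hp. split; [now apply SP_smooth_S1 with n O | exact (Hm p hp)]. Qed.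

Lemma SP_mU u f g : density u -> variation f -> variation g -> SP n k O (mU k u f g).
Proof.
  intros Hd Hf Hg. destruct (variation_vel u f Hd Hf) as [v V].
  destruct (variation_vel u g Hd Hg) as [z Z]. destruct Hd as [Hu [hu _]].
  apply SP_ext with (fun p => partial k u p * (v p * z p)
               + u p * (partial k v p * z p + v p * partial k z p)); auto.
  - intros p hp. symmetry. now apply (mU_vel n k O).
  - destruct V as [V _], Z as [Z _].
    repeat first [apply SP_plus | apply SP_mult | apply SP_partial]; auto.
Qed.

Lemma variation_mG u g h : density u -> variation g -> variation h -> SP n k O (mG k u g h).
Proof.
  intros Hd Hg Hh. destruct (variation_vel u g Hd Hg) as [z Z].
  destruct (variation_vel u h Hd Hh) as [w W]. destruct Hd as [Hu [hu _]].
  now apply (mG_SP n k O hk hO hc u Hu hu g h z w).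
Qed.

Lemma compat u g h j p : (j < n)%nat -> j <> k -> density u -> variation g -> variation h -> O p ->
  is_derive (fun y => mG k u g h (upd p j y)) (p j)
    (mG k u (mD k j u g) h p + mG k u g (mD k j u h) p).
Proof.
  intros hj hjk Hd Hg Hh hp.
  pose proof (SP_is_derive n k O _ j p (variation_mG u g h Hd Hg Hh) hj hp) as D.
  destruct (variation_vel u _ Hd (variation_partial u j hj hjk Hd)) as [v V].
  destruct (variation_vel u g Hd Hg) as [z Z].
  destruct (variation_vel u h Hd Hh) as [w W]. destruct Hd as [Hu [hu _]].
  now rewrite (compat_vel n k O hk hO hc u Hu hu j g h v z w p) in D.
Qed.

End Variations.

Lemma dom2_upd I p y : dom2 I p -> dom2 I (upd p 1 y).
Proof. auto. Qed.

Lemma dom3_upd W p y : dom3 W p -> dom3 W (upd p 2 y).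
Proof. auto. Qed.

Lemma density_cf2 I Phi i : curve_in_M3 I Phi -> density 2 1 (dom2 I) (cf2 Phi i).
Proof.
  intros [HM HS]. destruct (HS i) as [O [hO [hI H]]].
  split; [split |].
  - exact (fun m => Ck_sub 2 m O (dom2 I) _ hI (H m)).
  - intros p hp. destruct (M3_spec _ (HM _ hp) i) as [[Hp _] _]. exact (Hp (p 1%nat)).
  - split; intros p hp; destruct (M3_spec _ (HM _ hp) i) as [_ [H1 [H2 _]]].
    + apply H1.
    + exact H2.
Qed.

Lemma density_cf3 W Phi i : family_in_M3 W Phi -> density 3 2 (dom3 W) (cf3 Phi i).
Proof.
  intros [HM HS]. destruct (HS i) as [O [hO [hI H]]].
  split; [split |].
  - exact (fun m => Ck_sub 3 m O (dom3 W) _ hI (H m)).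
  - intros p hp. destruct (M3_spec _ (HM _ _ hp) i) as [[Hp _] _]. exact (Hp (p 2%nat)).
  - split; intros p hp; destruct (M3_spec _ (HM _ _ hp) i) as [_ [H1 [H2 _]]].
    + apply H1.
    + exact H2.
Qed.

Lemma variation_cf2 I Y i : field_along I Y -> variation 2 1 (dom2 I) (cf2 Y i).
Proof.
  intros [HT HS]. destruct (HS i) as [O [hO [hI H]]]. split; [split |].
  - exact (fun m => Ck_sub 2 m O (dom2 I) _ hI (H m)).
  - intros p hp. destruct (T3_spec _ (HT _ hp)) as [HC _].
    destruct (HC i) as [[Hp _] _]. exact (Hp (p 1%nat)).
  - intros p hp. destruct (T3_spec _ (HT _ hp)) as [HC _]. exact (proj2 (HC i)).
Qed.

Lemma variation_cf3 W Y i : field_along_family W Y -> variation 3 2 (dom3 W) (cf3 Y i).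
Proof.
  intros [HT HS]. destruct (HS i) as [O [hO [hI H]]]. split; [split |].
  - exact (fun m => Ck_sub 3 m O (dom3 W) _ hI (H m)).
  - intros p hp. destruct (T3_spec _ (HT _ _ hp)) as [HC _].
    destruct (HC i) as [[Hp _] _]. exact (Hp (p 2%nat)).
  - intros p hp. destruct (T3_spec _ (HT _ _ hp)) as [HC _]. exact (proj2 (HC i)).
Qed.

Lemma field_along_intro I Y : open I -> (forall t, I t -> shape (Y t)) ->
  (forall i, variation 2 1 (dom2 I) (cf2 Y i)) -> field_along I Y.
Proof.
  intros HI HS HV. split.
  - intros t ht. apply T3_intro; auto. intros i.
    exact (variation_C0inf 2 1 (dom2 I) ltac:(lia) (dom2_open I HI) (dom2_upd I) _ (fun _ => t) (HV i) ht).
  - intros i. exists (dom2 I). repeat split; auto using dom2_open. apply (HV i).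
Qed.

Lemma field_along_family_intro W Y : open2 W -> (forall s t, W s t -> shape (Y s t)) ->
  (forall i, variation 3 2 (dom3 W) (cf3 Y i)) -> field_along_family W Y.
Proof.
  intros HI HS HV. split.
  - intros s t ht. apply T3_intro; auto. intros i.
    exact (variation_C0inf 3 2 (dom3 W) ltac:(lia) (dom3_open W HI) (dom3_upd W) _
             (upd (fun _ => s) 1 t) (HV i) ht).
  - intros i. exists (dom3 W). repeat split; auto using dom3_open. apply (HV i).
Qed.

Lemma shape_covD_field I Phi Y t : open I -> field_along I Y -> I t -> shape (covD Phi Y t).
Proof.
  intros HI [HT _] ht. apply shape_covD, shape_dcurve.
  apply filter_imp with (2 := HI t ht). intros tau h. now apply T3_spec, HT.
Qed.

Lemma shape_D1 W Phi Y s t : open2 W -> field_along_family W Y -> W s t -> shape (D1 covD Phi Y s t).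
Proof.
  intros HW [HT _] ht. apply shape_covD, shape_dcurve.
  apply filter_imp with (2 := open2_1 W s t HW ht). intros sg h. now apply T3_spec, HT.
Qed.

Lemma shape_D2 W Phi Y s t : open2 W -> field_along_family W Y -> W s t -> shape (D2 covD Phi Y s t).
Proof.
  intros HW [HT _] ht. apply shape_covD, shape_dcurve.
  apply filter_imp with (2 := open2_2 W s t HW ht). intros tau h. now apply T3_spec, HT.
Qed.

Lemma field_along_covD I Phi Y : open I -> curve_in_M3 I Phi -> field_along I Y ->
  field_along I (covD Phi Y).
Proof.
  intros HI HP HY. apply field_along_intro; auto.
  - intros t ht. now apply shape_covD_field with I.
  - intros i. rewrite cf2_covD.
    apply variation_mD; try lia; auto using dom2_open, density_cf2, variation_cf2.
Qed.

Lemma field_along_D1 W Phi Y : open2 W -> family_in_M3 W Phi -> field_along_family W Y ->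
  field_along_family W (D1 covD Phi Y).
Proof.
  intros HW HP HY. apply field_along_family_intro; auto.
  - intros s t ht. now apply shape_D1 with W.
  - intros i. rewrite cf3_D1.
    apply variation_mD; try lia; auto using dom3_open, density_cf3, variation_cf3.
Qed.

Lemma field_along_D2 W Phi Y : open2 W -> family_in_M3 W Phi -> field_along_family W Y ->
  field_along_family W (D2 covD Phi Y).
Proof.
  intros HW HP HY. apply field_along_family_intro; auto.
  - intros s t ht. now apply shape_D2 with W.
  - intros i. rewrite cf3_D2.
    apply variation_mD; try lia; auto using dom3_open, density_cf3, variation_cf3.
Qed.

Lemma SP_ex_derive n k O F j p : SP n k O F -> (j < n)%nat -> O p ->
  ex_derive (fun h => F (upd p j h)) (p j).
Proof. intros H hj hp. eexists. now apply (SP_is_derive n k O). Qed.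

Lemma field_along_d1 W Phi : open2 W -> family_in_M3 W Phi -> field_along_family W (d1 Phi).
Proof.
  intros HW HP. apply field_along_family_intro; auto.
  - intros s t ht. apply shape_dcurve_M3.
    + apply filter_imp with (2 := open2_1 W s t HW ht). intros sg h. now apply HP.
    + intros i x. exact (SP_ex_derive 3 2 (dom3 W) _ 0 (upd (upd (fun _ => x) 0 s) 1 t)
                           (proj1 (density_cf3 W Phi i HP)) ltac:(lia) ht).
  - intros i. rewrite cf3_d1.
    apply variation_partial; try lia; auto using dom3_open, density_cf3.
Qed.

Lemma field_along_d2 W Phi : open2 W -> family_in_M3 W Phi -> field_along_family W (d2 Phi).
Proof.
  intros HW HP. apply field_along_family_intro; auto.
  - intros s t ht. apply shape_dcurve_M3.
    + apply filter_imp with (2 := open2_2 W s t HW ht). intros tau h. now apply HP.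
    + intros i x. exact (SP_ex_derive 3 2 (dom3 W) _ 1 (upd (upd (fun _ => x) 0 s) 1 t)
                           (proj1 (density_cf3 W Phi i HP)) ltac:(lia) ht).
  - intros i. rewrite cf3_d2.
    apply variation_partial; try lia; auto using dom3_open, density_cf3.
Qed.

Lemma field_along_dcurve I Phi : open I -> curve_in_M3 I Phi -> field_along I (dcurve Phi).
Proof.
  intros HI HP. apply field_along_intro; auto.
  - intros t ht. apply shape_dcurve_M3.
    + apply filter_imp with (2 := HI t ht). intros tau h. now apply HP.
    + intros i x. exact (SP_ex_derive 2 1 (dom2 I) _ 0 (upd (fun _ => x) 0 t)
                           (proj1 (density_cf2 I Phi i HP)) ltac:(lia) ht).
  - intros i. rewrite cf2_dcurve.
    apply variation_partial; try lia; auto using dom2_open, density_cf2.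
Qed.

Lemma covD_torsion_free : torsion_free covD.
Proof.
  intros W Phi HW HP s t ht. apply shape_eq.
  - apply shape_D1 with W; auto using field_along_d2.
  - apply shape_D2 with W; auto using field_along_d1.
  - intros i x. set (p := upd (upd (fun _ => x) 0 s) 1 t).
    change (cf3 (D1 covD Phi (d2 Phi)) i p = cf3 (D2 covD Phi (d1 Phi)) i p).
    rewrite cf3_D1, cf3_D2, cf3_d1, cf3_d2.
    destruct (density_cf3 W Phi i HP) as [Hu [hu _]].
    apply (mD_torsion 3 2 (dom3 W)); auto; try lia. now apply dom3_open.
Qed.

Lemma covD_metric_compatible : metric_compatible covD.
Proof.
  intros I Phi Y Z HI HP HY HZ t ht.
  (* Only coordinate 0 of [p] matters, since the integral overwrites the circle coordinate. *)
  set (p := fun _ : nat => t).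
  change (is_derive (fun tau => sum3 (fun i => mG 1 (cf2 Phi i) (cf2 Y i) (cf2 Z i) (upd p 0 tau))) t
    (sum3 (fun i => mG 1 (cf2 Phi i) (cf2 (covD Phi Y) i) (cf2 Z i) p)
     + sum3 (fun i => mG 1 (cf2 Phi i) (cf2 Y i) (cf2 (covD Phi Z) i) p))).
  rewrite <- sum3_plus.
  apply (is_derive_sum3 (fun i tau => mG 1 (cf2 Phi i) (cf2 Y i) (cf2 Z i) (upd p 0 tau))).
  intros i. rewrite !cf2_covD.
  apply (compat 2 1 (dom2 I) ltac:(lia) (dom2_open I HI) (dom2_upd I) _ _ _ 0 p);
    auto using density_cf2, variation_cf2; lia.
Qed.

Lemma smooth_S1_continuous f x : smooth_S1 f -> continuous f x.
Proof. intros [_ H]. apply (ex_derive_continuous f). exact (H 1%nat x Logic.I). Qed.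

Lemma Derive_U_lin u f g h a b x : smooth_S1 u -> (forall y, 0 < u y) ->
  smooth_S1 g -> smooth_S1 h -> ex_derive (U u f g) x -> ex_derive (U u f h) x ->
  Derive (U u f (fun y => a * g y + b * h y)) x = a * Derive (U u f g) x + b * Derive (U u f h) x.
Proof.
  intros Su hu Sg Sh dg dh.
  rewrite (Derive_ext _ (fun y => a * U u f g y + b * U u f h y)).
  - rewrite Derive_plus, !Derive_scal; auto; now apply ex_derive_scal.
  - intros y. apply U_lin; auto using smooth_S1_continuous.
Qed.

Lemma ex_derive_U_curve I Phi Y i t x : open I -> curve_in_M3 I Phi -> field_along I Y -> I t ->
  ex_derive (U (coef (Phi t) i) (fun y => Derive (fun tau => coef (Phi tau) i y) t) (coef (Y t) i)) x.
Proof.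
  intros HI HP HY ht.
  exact (SP_ex_derive 2 1 (dom2 I) _ 1 (upd (fun _ => x) 0 t)
    (SP_mU 2 1 (dom2 I) ltac:(lia) (dom2_open I HI) (dom2_upd I) _ _ _ (density_cf2 I Phi i HP)
       (variation_partial 2 1 (dom2 I) ltac:(lia) (dom2_open I HI) (dom2_upd I) _ 0
           ltac:(lia) ltac:(lia) (density_cf2 I Phi i HP))
       (variation_cf2 I Y i HY)) ltac:(lia) ht).
Qed.

Lemma ex_derive_coef_curve I Y i t x : field_along I Y -> I t ->
  ex_derive (fun tau => coef (Y tau) i x) t.
Proof.
  intros HY ht.
  exact (SP_ex_derive 2 1 (dom2 I) _ 0 (upd (fun _ => x) 0 t) (proj1 (variation_cf2 I Y i HY))
           ltac:(lia) ht).
Qed.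

Lemma field_smooth_S1 I Y i t : field_along I Y -> I t -> smooth_S1 (coef (Y t) i).
Proof. intros [H _] ht. exact (proj1 (proj1 (T3_spec _ (H t ht)) i)). Qed.

Lemma covD_additive I Phi Y Z t : open I ->
  curve_in_M3 I Phi -> field_along I Y -> field_along I Z -> I t ->
  teq (covD Phi (fun tau => tadd (Y tau) (Z tau)) t) (tadd (covD Phi Y t) (covD Phi Z t)).
Proof.
  intros HI HP HY HZ ht. apply shape_eq.
  - apply shape_covD, shape_dcurve. apply filter_imp with (2 := HI t ht). intros tau h.
    apply shape_tadd; apply T3_spec; [apply HY | apply HZ]; auto.
  - apply shape_tadd; now apply shape_covD_field with I.
  - intros i x. rewrite coef_tadd, !coef_covD.
    destruct (M3_spec _ (proj1 HP t ht) i) as [Su [hu _]].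
    replace (coef (tadd (Y t) (Z t)) i) with (fun y => 1 * coef (Y t) i y + 1 * coef (Z t) i y)
      by (apply functional_extensionality; intros y; rewrite coef_tadd; ring).
    rewrite Derive_U_lin; eauto using field_smooth_S1, ex_derive_U_curve.
    rewrite (Derive_ext _ (fun tau => coef (Y tau) i x + coef (Z tau) i x))
      by (intros; apply coef_tadd).
    rewrite Derive_plus by eauto using ex_derive_coef_curve. ring.
Qed.

Lemma covD_Leibniz I Phi Y c t : open I ->
  curve_in_M3 I Phi -> field_along I Y -> smooth1 I c -> I t ->
  teq (covD Phi (fun tau => tscale (c tau) (Y tau)) t)
      (tadd (tscale (Derive c t) (Y t)) (tscale (c t) (covD Phi Y t))).
Proof.
  intros HI HP HY Hc ht. apply shape_eq.
  - apply shape_covD, shape_dcurve. apply filter_imp with (2 := HI t ht). intros tau h.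
    apply shape_tscale, T3_spec, HY, h.
  - apply shape_tadd; apply shape_tscale.
    + apply T3_spec, HY, ht.
    + now apply shape_covD_field with I.
  - intros i x. rewrite coef_tadd, !coef_tscale, !coef_covD.
    destruct (M3_spec _ (proj1 HP t ht) i) as [Su [hu _]].
    (* The summand with factor 0 brings the scalar case into the two-term form of [Derive_U_lin]. *)
    replace (coef (tscale (c t) (Y t)) i) with (fun y => c t * coef (Y t) i y + 0 * coef (Y t) i y)
      by (apply functional_extensionality; intros y; rewrite coef_tscale; ring).
    rewrite Derive_U_lin; eauto using field_smooth_S1, ex_derive_U_curve.
    rewrite (Derive_ext _ (fun tau => c tau * coef (Y tau) i x))
      by (intros; apply coef_tscale).
    rewrite Derive_mult; eauto using ex_derive_coef_curve; [ring |].
    exact (Hc 1%nat t ht).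
Qed.

(** Differentiability in the two parameters comes from [partial 0] existing near the point and being
    continuous there, together with [partial 1] existing at the point. *)
Lemma is_derive_comp2 n O F p (sg tau : R -> R) r ds dt :
  (2 <= n)%nat -> open_n n O -> Sm n O F -> O p -> sg r = p 0%nat -> tau r = p 1%nat ->
  is_derive sg r ds -> is_derive tau r dt ->
  is_derive (fun a => F (upd (upd p 0 (sg a)) 1 (tau a))) r (ds * partial 0 F p + dt * partial 1 F p).
Proof.
  intros hn hO HF hp es et Ds Dt.
  assert (hp' : upd (upd p 0 (p 0%nat)) 1 (p 1%nat) = p) by now rewrite upd_id, upd_id.
  assert (D1 : forall a b, O (upd (upd p 0 a) 1 b) ->
    is_derive (fun z => F (upd (upd p 0 z) 1 b)) a (partial 0 F (upd (upd p 0 a) 1 b))).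
  { intros a b hq. rewrite upd_comm in hq |- * by auto.
    apply is_derive_ext with (fun z => F (upd (upd p 1 b) 0 z)).
    - intros z. now rewrite upd_comm by auto.
    - apply Sm_is_derive with n O; auto. lia. }
  assert (HD : differentiable_pt_lim (fun a b => F (upd (upd p 0 a) 1 b)) (sg r) (tau r)
                 (partial 0 F p) (partial 1 F p)).
  { rewrite es, et. apply filterdiff_differentiable_pt_lim.
    replace (partial 0 F p) with (partial 0 F (upd (upd p 0 (p 0%nat)) 1 (p 1%nat)))
      by now rewrite hp'.
    apply (is_derive_filterdiff (fun a b => F (upd (upd p 0 a) 1 b)) (p 0%nat) (p 1%nat)
             (fun a b => partial 0 F (upd (upd p 0 a) 1 b)) (partial 1 F p)).
    - assert (hl := nbhd_upd_plane n p 0 1 (p 0%nat) (p 1%nat)). rewrite hp' in hl.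
      destruct (hl O (hO p hp)) as [d hd]. exists d. intros [a b] hq. apply D1. exact (hd _ hq).
    - rewrite upd_id. apply Sm_is_derive0 with n O; auto.
    - apply (continuity_2d_pt_filterlim (fun a b => partial 0 F (upd (upd p 0 a) 1 b))).
      apply (cont_at_plane n (partial 0 F) p 0 1). simpl fst; simpl snd. rewrite hp'.
      apply Sm_cont with O; auto. apply Sm_partial; auto. lia. }
  apply is_derive_Reals in Ds, Dt. apply is_derive_Reals.
  rewrite (Rmult_comm ds), (Rmult_comm dt).
  exact (derivable_pt_lim_comp_2d _ _ _ _ _ _ _ _ HD Ds Dt).
Qed.

Lemma covD_chain W Phi Y J sg tau r : open2 W -> open J ->
  family_in_M3 W Phi -> field_along_family W Y ->
  smooth1 J sg -> smooth1 J tau -> (forall r, J r -> W (sg r) (tau r)) -> J r ->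
  teq (covD (fun a => Phi (sg a) (tau a)) (fun a => Y (sg a) (tau a)) r)
      (tadd (tscale (Derive sg r) (D1 covD Phi Y (sg r) (tau r)))
            (tscale (Derive tau r) (D2 covD Phi Y (sg r) (tau r)))).
Proof.
  intros HW HJ HP HY Hs Ht HWJ hr. assert (hW := HWJ r hr). apply shape_eq.
  - apply shape_covD, shape_dcurve. apply filter_imp with (2 := HJ r hr). intros a h.
    apply T3_spec, HY, HWJ, h.
  - apply shape_tadd; apply shape_tscale; [now apply shape_D1 with W | now apply shape_D2 with W].
  - intros i x. rewrite coef_tadd, !coef_tscale. unfold D1, D2. rewrite !coef_covD.
    assert (Ds := Derive_correct sg r (Hs 1%nat r hr)).
    assert (Dt := Derive_correct tau r (Ht 1%nat r hr)).
    set (p := fun y : R => upd (upd (fun _ => y) 0 (sg r)) 1 (tau r)).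
    assert (C : forall F y, SP 3 2 (dom3 W) F ->
      Derive (fun a => F (upd (upd (p y) 0 (sg a)) 1 (tau a))) r
      = Derive sg r * partial 0 F (p y) + Derive tau r * partial 1 F (p y)).
    { intros F y [HF _]. apply is_derive_unique.
      now apply (is_derive_comp2 3 (dom3 W) F (p y) sg tau r _ _ ltac:(lia) (dom3_open W HW)). }
    assert (EY := C _ x (proj1 (variation_cf3 W Y i HY))).
    assert (EP := fun y => C _ y (proj1 (density_cf3 W Phi i HP))).
    change (Derive (fun a => coef (Y (sg a) (tau a)) i x) r
      = Derive sg r * Derive (fun s => coef (Y s (tau r)) i x) (sg r)
        + Derive tau r * Derive (fun t => coef (Y (sg r) t) i x) (tau r)) in EY.
    change (forall y, Derive (fun a => coef (Phi (sg a) (tau a)) i y) r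
      = Derive sg r * Derive (fun s => coef (Phi s (tau r)) i y) (sg r)
        + Derive tau r * Derive (fun t => coef (Phi (sg r) t) i y) (tau r)) in EP.
    rewrite EY, (functional_extensionality _ _ EP).
    destruct (M3_spec _ (proj1 HP _ _ hW) i) as [Su [hu _]].
    assert (V := fun j hj hj' => variation_partial 3 2 (dom3 W) ltac:(lia) (dom3_open W HW)
                   (dom3_upd W) _ j hj hj' (density_cf3 W Phi i HP)).
    assert (V0 := V 0%nat ltac:(lia) ltac:(lia)). assert (V1 := V 1%nat ltac:(lia) ltac:(lia)).
    assert (S : forall f, variation 3 2 (dom3 W) f -> smooth_S1 (fun y => f (upd (p x) 2 y))).
    { intros f Hf. apply (variation_C0inf 3 2 (dom3 W) ltac:(lia) (dom3_open W HW)
                   (dom3_upd W) f (p x) Hf hW). }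
    assert (HU : forall f, variation 3 2 (dom3 W) f ->
      ex_derive (U (coef (Phi (sg r) (tau r)) i) (coef (Y (sg r) (tau r)) i)
                   (fun y => f (upd (p x) 2 y))) x).
    { intros f Hf. rewrite (functional_extensionality _ _ (U_sym _ _ _)).
      assert (HS := SP_mU 3 2 (dom3 W) ltac:(lia) (dom3_open W HW) (dom3_upd W) _ f _
           (density_cf3 W Phi i HP) Hf (variation_cf3 W Y i HY)).
      apply ex_derive_ext with (2 := SP_ex_derive 3 2 (dom3 W) _ 2 (p x) HS ltac:(lia) hW).
      intros h. apply (f_equal (fun F => U (coef (Phi (sg r) (tau r)) i) F (coef (Y (sg r) (tau r)) i) h)).
      apply functional_extensionality. intros y. now rewrite upd_upd. }
    (* [Derive_U_lin] concerns the last argument of [U]; symmetry moves the velocity of the base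
       curve there. *)
    rewrite !(functional_extensionality _ _ (U_sym _ _ (coef (Y (sg r) (tau r)) i))).
    pose (A0 := Derive (U (coef (Phi (sg r) (tau r)) i) (coef (Y (sg r) (tau r)) i)
                          (fun y => partial 0 (cf3 Phi i) (upd (p x) 2 y))) x).
    pose (A1 := Derive (U (coef (Phi (sg r) (tau r)) i) (coef (Y (sg r) (tau r)) i)
                          (fun y => partial 1 (cf3 Phi i) (upd (p x) 2 y))) x).
    assert (E := Derive_U_lin _ _ _ _ (Derive sg r) (Derive tau r) _
                   Su hu (S _ V0) (S _ V1) (HU _ V0) (HU _ V1)).
    etransitivity; [apply f_equal; exact E |].
    change (Derive sg r * Derive (fun s => coef (Y s (tau r)) i x) (sg r)
      + Derive tau r * Derive (fun t => coef (Y (sg r) t) i x) (tau r)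
      - (Derive sg r * A0 + Derive tau r * A1)
      = Derive sg r * (Derive (fun s => coef (Y s (tau r)) i x) (sg r) - A0)
        + Derive tau r * (Derive (fun t => coef (Y (sg r) t) i x) (tau r) - A1)).
    ring.
Qed.

Lemma covD_Levi_Civita : is_Levi_Civita covD.
Proof.
  split; [| exact (conj covD_torsion_free covD_metric_compatible)].
  split; [| split; [| split; [| split; [| split]]]].
  - intros I Phi Phi' Y Y' HI _ _ H t ht. apply covD_ext.
    now apply filter_imp with (2 := HI t ht).
  - exact field_along_covD.
  - intros W Phi Y HW HP HY. split; [now apply field_along_D1 | now apply field_along_D2].
  - intros I Phi Y Z HI HP HY HZ t ht. now apply covD_additive with I.
  - intros I Phi Y c HI HP HY Hc t ht. now apply covD_Leibniz with I.
  - intros W Phi Y J sg tau HW HJ HP HY Hs Ht HWJ r hr. now apply covD_chain with W J.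
Qed.

(** * Concave functions *)

Lemma MVT_is_derive (f df : R -> R) a b : a < b ->
  (forall x, a <= x <= b -> is_derive f x (df x)) ->
  exists c, a < c < b /\ f b - f a = df c * (b - a).
Proof.
  intros hab Hd. destruct (MVT_cor2 f df a b hab) as [c [E hc]].
  - intros x hx. now apply is_derive_Reals, Hd.
  - eauto.
Qed.

Lemma is_derive_continuity f x l : is_derive f x l -> continuity_pt f x.
Proof.
  intros H. apply continuity_pt_filterlim. apply (ex_derive_continuous f). now exists l.
Qed.

Lemma nonincreasing_of_derive (f df : R -> R) a b : a <= b ->
  (forall x, a < x < b -> is_derive f x (df x) /\ df x <= 0) ->
  (forall x, a <= x <= b -> continuity_pt f x) -> f b <= f a.
Proof.
  intros hab Hd Hc. destruct hab as [hab | ->]; [| apply Rle_refl].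
  (* The intermediate point may be an end point, where [df] has no known sign. Truncation at 0
     changes nothing in the interior and makes the value nonpositive everywhere. *)
  destruct (MVT_gen f a b (fun x => Rmin (df x) 0)) as [c [hc E]].
  - rewrite Rmin_left, Rmax_right by lra. intros x hx. destruct (Hd x hx) as [h1 h2].
    rewrite Rmin_left by auto. auto.
  - rewrite Rmin_left, Rmax_right by lra. auto.
  - assert (h : Rmin (df c) 0 <= 0) by apply Rmin_r. nra.
Qed.

(** The mean value theorem on either side of the intermediate point [z] expresses the two slopes as
    values of [f1], which is nonincreasing. *)
Lemma concave_of_derive2 (I : R -> Prop) (f f1 f2 : R -> R) : is_interval I ->
  (forall x, I x -> is_derive f x (f1 x)) ->
  (forall x, I x -> is_derive f1 x (f2 x)) ->
  (forall x, I x -> f2 x <= 0) -> concave_on I f.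
Proof.
  intros HI H1 H2 H3.
  assert (main : forall x y l, I x -> I y -> x < y -> 0 < l < 1 ->
    l * f x + (1 - l) * f y <= f (l * x + (1 - l) * y)).
  { intros x y l hx hy hxy hl. set (z := l * x + (1 - l) * y).
    assert (hxz : x < z) by (unfold z; nra). assert (hzy : z < y) by (unfold z; nra).
    assert (HJ : forall w, x <= w <= y -> I w) by (intros w hw; exact (HI x y w hx hy hw)).
    destruct (MVT_is_derive f f1 x z hxz) as [c [hc Ec]].
    { intros w hw. apply H1, HJ. lra. }
    destruct (MVT_is_derive f f1 z y hzy) as [d [hd Ed]].
    { intros w hw. apply H1, HJ. lra. }
    assert (hcd : f1 d <= f1 c).
    { apply nonincreasing_of_derive with f2; [lra | |].
      - intros w hw. split; [apply H2 | apply H3]; apply HJ; lra.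
      - intros w hw. apply is_derive_continuity with (f2 w), H2, HJ. lra. }
    assert (E1 : z - x = (1 - l) * (y - x)) by (unfold z; ring).
    assert (E2 : y - z = l * (y - x)) by (unfold z; ring).
    rewrite E1 in Ec. rewrite E2 in Ed.
    assert (0 <= l * (1 - l) * (y - x) * (f1 c - f1 d)).
    { repeat apply Rmult_le_pos; lra. }
    replace (f z - (l * f x + (1 - l) * f y)) with (l * (f z - f x) - (1 - l) * (f y - f z))
      in * by ring.
    enough (0 <= l * (f z - f x) - (1 - l) * (f y - f z)) by lra.
    rewrite Ec, Ed. lra. }
  intros x y l hx hy hl.
  destruct (Req_dec l 0) as [-> | h0].
  { replace (0 * x + (1 - 0) * y) with y by ring. lra. }
  destruct (Req_dec l 1) as [-> | h1].
  { replace (1 * x + (1 - 1) * y) with x by ring. lra. }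
  destruct (Rtotal_order x y) as [h | [-> | h]].
  - apply main; auto. lra.
  - replace (l * y + (1 - l) * y) with y by ring. lra.
  - pose proof (main y x (1 - l) hy hx h ltac:(lra)) as H.
    replace (1 - (1 - l)) with l in H by ring.
    rewrite (Rplus_comm (l * x)). lra.
Qed.

Lemma concave_derive2_nonpos f x : smooth1 (fun x => 0 < x) f ->
  concave_on (fun x => 0 < x) f -> 0 < x -> Derive_n f 2 x <= 0.
Proof.
  intros Hf Hc hx. apply Rnot_lt_le. intros Hpos.
  assert (D1 : forall y, 0 < y -> is_derive f y (Derive f y)).
  { intros y hy. apply Derive_correct. exact (Hf 1%nat y hy). }
  assert (D2 : is_derive (Derive f) x (Derive_n f 2 x)).
  { apply (Derive_correct (Derive f)). exact (Hf 2%nat x hx). }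
  (* [f (x + h) + f (x - h)] has derivative [f' (x + h) - f' (x - h)], positive for small [h]. *)
  set (c := Derive_n f 2 x) in *.
  apply is_derive_Reals in D2.
  destruct (D2 (c / 2) ltac:(lra)) as [d Hd].
  (* Half of [d] stays within the range of the difference quotient estimate; half of [x] keeps
     [x - h] positive. *)
  set (e := Rmin (d / 2) (x / 2)).
  assert (he : 0 < e) by (apply Rmin_pos; [pose proof (cond_pos d) |]; lra).
  assert (hed : e <= d / 2) by apply Rmin_l. assert (hex : e <= x / 2) by apply Rmin_r.
  assert (hd0 := cond_pos d).
  assert (Hlow : forall h, 0 < h <= e -> Derive f (x - h) < Derive f (x + h)).
  { intros h hh.
    pose proof (Hd h ltac:(lra) ltac:(rewrite Rabs_right; lra)) as P1.
    pose proof (Hd (- h) ltac:(lra) ltac:(rewrite Rabs_left; lra)) as P2.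
    apply Rabs_def2 in P1, P2.
    assert (Q1 : c / 2 * h < Derive f (x + h) - Derive f x).
    { apply Rmult_lt_reg_r with (/ h); [apply Rinv_0_lt_compat; lra |].
      replace (c / 2 * h * / h) with (c / 2) by (field; lra). unfold Rdiv in P1. lra. }
    assert (Q2 : c / 2 * h < Derive f x - Derive f (x + - h)).
    { apply Rmult_lt_reg_r with (/ h); [apply Rinv_0_lt_compat; lra |].
      replace (c / 2 * h * / h) with (c / 2) by (field; lra).
      replace ((Derive f x - Derive f (x + - h)) * / h)
        with ((Derive f (x + - h) - Derive f x) / - h) by (field; lra). lra. }
    unfold Rminus. assert (0 < c / 2 * h) by (apply Rmult_lt_0_compat; lra). lra. }
  assert (DG : forall h, 0 <= h <= e -> is_derive (fun h => f (x + h) + f (x - h)) h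
                 (Derive f (x + h) - Derive f (x - h))).
  { intros h hh. auto_derive.
    - repeat split; eexists; apply D1; lra.
    - change (Derive (fun y => f y) (x + h)) with (Derive f (x + h)).
      change (Derive (fun y => f y) (x + - h)) with (Derive f (x - h)). ring. }
  destruct (MVT_is_derive _ _ 0 e he DG) as [h [hh E]].
  rewrite Rplus_0_r, Rminus_0_r, Rminus_0_r in E.
  assert (Hl := Hlow h ltac:(lra)).
  assert (0 < (Derive f (x + h) - Derive f (x - h)) * e) by (apply Rmult_lt_0_compat; lra).
  pose proof (Hc (x + e) (x - e) (/ 2) ltac:(lra) ltac:(lra) ltac:(lra)) as HC.
  replace (/ 2 * (x + e) + (1 - / 2) * (x - e)) with x in HC by field. lra.
Qed.

(** * Geodesics and sectional curvature *)

Lemma Vol_derive chi I Phi t : open I -> (forall i, smooth1 (fun x => 0 < x) (chi i)) ->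
  curve_in_M3 I Phi -> I t ->
  is_derive (fun tau => Vol chi (Phi tau)) t
    (sum3 (fun i => mean 1 (fun q => Derive_n (chi i) 1 (cf2 Phi i q) * partial 0 (cf2 Phi i) q)
                      (fun _ => t))).
Proof.
  intros HI Hchi HP ht. set (p := fun _ : nat => t).
  apply (is_derive_sum3 (fun i tau => mean 1 (fun q => chi i (cf2 Phi i q)) (upd p 0 tau))).
  intros i. destruct (density_cf2 I Phi i HP) as [Hu [hu _]].
  assert (hk : (1 < 2)%nat) by lia. assert (hj : (0 < 2)%nat) by lia.
  assert (hO := dom2_open I HI). assert (hc := dom2_upd I).
  assert (Hx : SP 2 1 (dom2 I) (fun q => chi i (cf2 Phi i q)))
    by exact (SP_comp 2 1 (dom2 I) hO _ (fun x => 0 < x) (chi i) 0 (Hchi i) hu Hu).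
  pose proof (SP_is_derive 2 1 (dom2 I) _ 0 p (SP_mean 2 1 (dom2 I) hk hO hc _ Hx) hj ht) as D.
  rewrite (volume_partial 2 1 (dom2 I) hO hc (cf2 Phi i) Hu hu (chi i) 0 p) in D; auto.
Qed.

Lemma Vol_derive2 chi I Phi t : open I -> (forall i, smooth1 (fun x => 0 < x) (chi i)) ->
  is_geodesic I Phi -> I t ->
  is_derive (Derive (fun tau => Vol chi (Phi tau))) t
    (sum3 (fun i =>
       RInt (fun x => Derive_n (chi i) 2 (coef (Phi t) i x)
                      * (K (coef (Phi t) i) (coef (dcurve Phi t) i) x) ^ 2) 0 1)).
Proof.
  intros HI Hchi [HP Hgeo] ht. set (p := fun _ : nat => t).
  apply (is_derive_ext_loc (fun tau => sum3 (fun i =>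
    mean 1 (fun q => Derive_n (chi i) 1 (cf2 Phi i q) * partial 0 (cf2 Phi i) q) (upd p 0 tau)))).
  { apply filter_imp with (2 := HI t ht). intros tau h. symmetry. apply is_derive_unique.
    exact (Vol_derive chi I Phi tau HI Hchi HP h). }
  apply (is_derive_sum3 (fun i tau => mean 1 (fun q =>
    Derive_n (chi i) 1 (cf2 Phi i q) * partial 0 (cf2 Phi i) q) (upd p 0 tau))).
  intros i. destruct (density_cf2 I Phi i HP) as [Hu [hu _]].
  assert (hk : (1 < 2)%nat) by lia. assert (hj : (0 < 2)%nat) by lia.
  assert (hO := dom2_open I HI). assert (hc := dom2_upd I).
  assert (hjk : 0%nat <> 1%nat) by auto.
  assert (Hx : SP 2 1 (dom2 I) (fun q => Derive_n (chi i) 1 (cf2 Phi i q) * partial 0 (cf2 Phi i) q)).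
  { apply SP_mult; auto.
    - exact (SP_comp 2 1 (dom2 I) hO _ (fun x => 0 < x) (chi i) 1 (Hchi i) hu Hu).
    - now apply SP_partial. }
  pose proof (SP_is_derive 2 1 (dom2 I) _ 0 p (SP_mean 2 1 (dom2 I) hk hO hc _ Hx) hj ht) as D.
  destruct (variation_vel 2 1 (dom2 I) hk hO hc _ _ (density_cf2 I Phi i HP)
    (variation_partial 2 1 (dom2 I) hk hO hc _ 0 hj hjk (density_cf2 I Phi i HP))) as [z Z].
  assert (G : forall q, dom2 I q -> partial 0 (partial 0 (cf2 Phi i)) q
    = partial 1 (mU 1 (cf2 Phi i) (partial 0 (cf2 Phi i)) (partial 0 (cf2 Phi i))) q).
  { intros q hq. pose proof (Hgeo (q 0%nat) i (q 1%nat) hq) as G.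
    rewrite Utilde_U, coef_dcurve in G. rewrite <- (cf2_dcurve Phi i) at 1.
    exact G. }
  assert (E := volume_partial2 2 1 (dom2 I) hk hO hc (cf2 Phi i) Hu hu (chi i) 0 z p
                 hj hjk ht (Hchi i) Z G).
  rewrite E in D. rewrite coef_dcurve. exact D.
Qed.

Lemma metric_ext phi phi' X X' Y Y' : teq phi phi' -> teq X X' -> teq Y Y' ->
  metric phi X Y = metric phi' X' Y'.
Proof.
  intros H1 H2 H3. apply sum3_ext. intros i.
  now rewrite (coef_ext _ _ i H1), (coef_ext _ _ i H2), (coef_ext _ _ i H3).
Qed.

Lemma discriminant_nonneg A B C :
  (forall a b, 0 <= a ^ 2 * A + 2 * a * b * B + b ^ 2 * C) -> 0 <= A * C - B ^ 2.
Proof.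
  intros H. assert (hA := H 1 0). assert (hC := H 0 1).
  destruct (Req_dec A 0) as [-> | hA0].
  - destruct (Req_dec B 0) as [-> | hB0]; [lra |].
    (* The form, linear in [a] when [A = 0], takes the value -1 here, so [B] has to vanish. *)
    pose proof (H (- (C + 1) / (2 * B)) 1) as h. exfalso.
    replace ((- (C + 1) / (2 * B)) ^ 2 * 0 + 2 * (- (C + 1) / (2 * B)) * 1 * B + 1 ^ 2 * C)
      with (-1) in h by (field; auto). lra.
  - assert (hpos : 0 < A) by lra. pose proof (H (- B) A) as h.
    replace ((- B) ^ 2 * A + 2 * - B * A * B + A ^ 2 * C) with (A * (A * C - B ^ 2)) in h by ring.
    apply Rmult_le_reg_l with A; lra.
Qed.

(** Metric and curvature are sums over the three densities, so the numerator is a sum of three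
    nonnegative terms given by [curvature_vel]. The denominator is a Gram determinant, nonnegative
    by Cauchy-Schwarz for the summed metric. *)
Lemma sectional_curvature_nonneg phi X Y kappa :
  is_sectional_curvature covD phi X Y kappa -> 0 <= kappa.
Proof.
  intros [W [Phi [s [t [HW [HP [hW [E1 [E2 [E3 ->]]]]]]]]]].
  assert (E0 : forall X, teq X X) by (intros Z i p v1 v2 v3; reflexivity).
  assert (sym : forall X Y, teq X Y -> teq Y X)
    by (intros Z Z' h i p v1 v2 v3; symmetry; apply h).
  set (R := curvature covD Phi (d2 Phi)).
  rewrite (metric_ext phi (Phi s t) (R s t) (R s t) X (d1 Phi s t)) by auto.
  rewrite (metric_ext phi (Phi s t) X (d1 Phi s t) X (d1 Phi s t)) by auto.
  rewrite (metric_ext phi (Phi s t) X (d1 Phi s t) Y (d2 Phi s t)) by auto.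
  rewrite (metric_ext phi (Phi s t) Y (d2 Phi s t) Y (d2 Phi s t)) by auto.
  set (p := upd (fun _ => s) 1 t).
  assert (EM : forall A B : family2, metric (Phi s t) (A s t) (B s t)
    = sum3 (fun i => mG 2 (cf3 Phi i) (cf3 A i) (cf3 B i) p)) by reflexivity.
  rewrite !EM.
  assert (hk : (2 < 3)%nat) by lia. assert (hi : (0 < 3)%nat) by lia. assert (hj : (1 < 3)%nat) by lia.
  assert (hik : 0%nat <> 2%nat) by auto. assert (hjk : 1%nat <> 2%nat) by auto.
  assert (hij : 0%nat <> 1%nat) by auto.
  assert (hO := dom3_open W HW). assert (hc := dom3_upd W).
  assert (hp : dom3 W p) by exact hW.
  assert (HV : forall i, exists v w, vel 3 2 (dom3 W) (cf3 Phi i) (partial 0 (cf3 Phi i)) v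
    /\ vel 3 2 (dom3 W) (cf3 Phi i) (partial 1 (cf3 Phi i)) w).
  { intros i. assert (Hd := density_cf3 W Phi i HP).
    destruct (variation_vel 3 2 (dom3 W) hk hO hc _ _ Hd
      (variation_partial 3 2 (dom3 W) hk hO hc _ 0 hi hik Hd)) as [v V].
    destruct (variation_vel 3 2 (dom3 W) hk hO hc _ _ Hd
      (variation_partial 3 2 (dom3 W) hk hO hc _ 1 hj hjk Hd)) as [w V'].
    exists v, w. auto. }
  assert (HR : forall i, 0 <= mG 2 (cf3 Phi i) (cf3 R i) (cf3 (d1 Phi) i) p).
  { intros i. destruct (HV i) as [v [w [V V']]]. destruct (density_cf3 W Phi i HP) as [Hu [hu _]].
    assert (ER : cf3 R i = fun q =>
      mD 2 0 (cf3 Phi i) (mD 2 1 (cf3 Phi i) (partial 1 (cf3 Phi i))) q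
      - mD 2 1 (cf3 Phi i) (mD 2 0 (cf3 Phi i) (partial 1 (cf3 Phi i))) q).
    { rewrite <- cf3_d2, <- cf3_D2, <- cf3_D1, <- cf3_D1, <- cf3_D2.
      apply functional_extensionality. intros q. unfold cf3 at 1, R, curvature.
      rewrite coef_tadd, coef_tscale. unfold cf3. ring. }
    rewrite ER, cf3_d1.
    rewrite (curvature_vel 3 2 (dom3 W) hk hO hc _ Hu hu 0 1 v w p hi hj hik hjk hij hp V V').
    pose proof (mean_inv_pos 3 2 (dom3 W) hO hc _ Hu hu p hp) as hM.
    apply Rmult_le_pos; [| now apply Rlt_le, Rinv_0_lt_compat].
    apply Rmult_le_pos; [lra | apply pow2_ge_0]. }
  assert (HD : 0 <= sum3 (fun i => mG 2 (cf3 Phi i) (cf3 (d1 Phi) i) (cf3 (d1 Phi) i) p)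
    * sum3 (fun i => mG 2 (cf3 Phi i) (cf3 (d2 Phi) i) (cf3 (d2 Phi) i) p)
    - sum3 (fun i => mG 2 (cf3 Phi i) (cf3 (d1 Phi) i) (cf3 (d2 Phi) i) p) ^ 2).
  { apply discriminant_nonneg. intros a b.
    assert (HQ : forall i, 0 <= a ^ 2 * mG 2 (cf3 Phi i) (cf3 (d1 Phi) i) (cf3 (d1 Phi) i) p
      + 2 * a * b * mG 2 (cf3 Phi i) (cf3 (d1 Phi) i) (cf3 (d2 Phi) i) p
      + b ^ 2 * mG 2 (cf3 Phi i) (cf3 (d2 Phi) i) (cf3 (d2 Phi) i) p).
    { intros i. destruct (HV i) as [v [w [V V']]].
      destruct (density_cf3 W Phi i HP) as [Hu [hu _]]. rewrite cf3_d1, cf3_d2.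
      rewrite (mG_vel 3 2 (dom3 W) hk hO hc _ Hu hu _ _ v v p V V hp).
      rewrite (mG_vel 3 2 (dom3 W) hk hO hc _ Hu hu _ _ v w p V V' hp).
      rewrite (mG_vel 3 2 (dom3 W) hk hO hc _ Hu hu _ _ w w p V' V' hp).
      destruct V as [Hv _], V' as [Hw _]. set (u := cf3 Phi i) in *.
      assert (S2 : forall f g, SP 3 2 (dom3 W) f -> SP 3 2 (dom3 W) g ->
                SP 3 2 (dom3 W) (fun q => u q * f q * g q)).
      { intros f g Hf Hg. apply (SP_mult 3 2 _ hO (fun q => u q * f q)); auto. now apply SP_mult. }
      assert (S3 : forall c f, SP 3 2 (dom3 W) f -> SP 3 2 (dom3 W) (fun q => c * f q)).
      { intros c f Hf. apply (SP_mult 3 2 _ hO (fun _ => c)); auto. now apply SP_const. }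
      assert (KC : forall c, kconst 2 (dom3 W) (fun _ => c)) by (intros c q y _; reflexivity).
      rewrite <- !(mean_scal 3 2 (dom3 W) hc (fun _ => _)) by auto.
      rewrite <- !(mean_plus 3 2 (dom3 W) hc) by (repeat apply SP_plus; auto).
      rewrite (mean_ext 2 (dom3 W) hc _ (fun q => u q * (a * v q + b * w q) * (a * v q + b * w q)));
        auto; [| intros; ring].
      apply (mean_nonneg 3 2 (dom3 W) hc); auto.
      - apply S2; apply SP_plus; auto.
      - intros q hq. rewrite Rmult_assoc. apply Rmult_le_pos; [apply Rlt_le, hu, hq | apply Rle_0_sqr]. }
    assert (h1 := HQ i1). assert (h2 := HQ i2). assert (h3 := HQ i3). unfold sum3. lra. }
  assert (HN : 0 <= sum3 (fun i => mG 2 (cf3 Phi i) (cf3 R i) (cf3 (d1 Phi) i) p)).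
  { assert (h1 := HR i1). assert (h2 := HR i2). assert (h3 := HR i3). unfold sum3. lra. }
  apply Rmult_le_pos; auto.
  destruct HD as [HD | <-].
  - now apply Rlt_le, Rinv_0_lt_compat.
  (* A vanishing Gram determinant makes the quotient 0, as [/ 0 = 0]. *)
  - rewrite Rinv_0. lra.
Qed.

(** * The flow *)

Definition clamp (a b x : R) : R := Rmax a (Rmin b x).

Lemma clamp_range a b x : a <= b -> a <= clamp a b x <= b.
Proof.
  intros h. split; [apply Rmax_l |]. apply Rmax_lub; auto. apply Rmin_l.
Qed.

Lemma clamp_id a b x : a <= x <= b -> clamp a b x = x.
Proof. intros h. unfold clamp. rewrite Rmin_right, Rmax_right; lra. Qed.

Lemma clamp_lipschitz a b x y : Rabs (clamp a b y - clamp a b x) <= Rabs (y - x).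
Proof.
  unfold clamp, Rmin. destruct (Rle_dec b y), (Rle_dec b x); unfold Rmax;
    repeat match goal with |- context [Rle_dec ?u ?v] => destruct (Rle_dec u v) end;
    split_Rabs; lra.
Qed.

(** The flow is only given for parameters in a closed rectangle; precomposing with
    this retraction makes its energy continuous everywhere. *)
Definition retract (a b : R) (p : vec) : vec :=
  upd (upd p 0 (clamp a b (p 0%nat))) 1 (clamp 0 1 (p 1%nat)).

Lemma cont_at_retract n F a b p : cont_at n F (retract a b p) ->
  cont_at n (fun q => F (retract a b q)) p.
Proof.
  intros H eps heps. destruct (H eps heps) as [d [hd Hd]]. exists d. split; auto.
  intros q hq. apply Hd. intros j hj. specialize (hq j hj). unfold retract, upd.
  destruct j as [|[|j]]; simpl; auto; eapply Rle_lt_trans; try apply clamp_lipschitz; auto.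
Qed.

(** Expresses [Q] through operations that preserve continuity in all variables. *)
Lemma mQ_prim k u g p : mQ k u g p
  = prim k g p - mean k (fun q => / u q * prim k g q) p * / mean k (fun q => / u q) p.
Proof.
  unfold mQ, Q. unfold Rminus. do 3 f_equal. apply RInt_Rext. intros y.
  unfold prim. rewrite upd_same. f_equal. apply RInt_Rext. intros z. now rewrite upd_upd.
Qed.

Lemma mG_ext k u u' g g' p : (forall y, u (upd p k y) = u' (upd p k y)) ->
  (forall y, g (upd p k y) = g' (upd p k y)) -> mG k u g g p = mG k u' g' g' p.
Proof.
  intros Hu Hg. unfold mG.
  rewrite (functional_extensionality _ _ Hu), (functional_extensionality _ _ Hg).
  apply RInt_Rext. intros x. now rewrite Hu.
Qed.

Lemma cont_at_mG n k u g p : (k < n)%nat -> (forall q, 0 < u q) ->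
  (forall q, cont_at n u q) -> (forall q, cont_at n g q) -> cont_at n (mG k u g g) p.
Proof.
  intros hk hu cu cg. set (T := fun _ : vec => True).
  assert (hT : open_n n T) by (intros q _; exists 1; split; [lra | exact (fun _ _ => Logic.I)]).
  assert (hc : forall q y, T q -> T (upd q k y)) by auto.
  assert (hu0 : forall q, u q <> 0) by (intros q; apply Rgt_not_eq, hu).
  assert (cp : cont_on n T (prim k g)) by (apply cont_on_prim; auto; intros q _; auto).
  assert (ci : cont_on n T (fun q => / u q)) by (intros q _; apply cont_at_inv; auto).
  assert (cm : cont_on n T (mean k (fun q => / u q))) by now apply cont_on_mean.
  assert (cm2 : cont_on n T (mean k (fun q => / u q * prim k g q))).
  { apply cont_on_mean; auto. intros q hq. apply cont_at_mult; auto. }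
  assert (hm : forall q, mean k (fun q => / u q) q <> 0).
  { intros q. apply Rgt_not_eq. apply RInt_gt_0; [lra | |].
    - intros y _. apply Rinv_0_lt_compat, hu.
    - intros y _. apply (cont_on_line n k T hc (fun q => / u q) q y ci Logic.I). }
  assert (cQ : cont_on n T (mQ k u g)).
  { intros q hq. apply cont_at_ext with T
      (fun q => prim k g q + - (mean k (fun q => / u q * prim k g q) q * / mean k (fun q => / u q) q)); auto.
    - intros q' _. now rewrite mQ_prim.
    - apply cont_at_plus; auto. apply cont_at_opp, cont_at_mult; auto. apply cont_at_inv; auto. }
  apply cont_at_ext with T (mean k (fun q => / u q * mQ k u g q * mQ k u g q)); auto.
  - exact Logic.I.
  - intros q hq. apply RInt_Rext. intros x. now rewrite <- !(mQ_upd k T u).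
  - apply (cont_on_mean n k T); [auto .. | | exact Logic.I]. intros q hq.
    apply cont_at_mult; [apply cont_at_mult |]; auto.
Qed.

Lemma limit_nonneg (f : R -> R) x : (forall y, continuous f y) ->
  (forall y, 0 < y < 1 -> 0 <= f y) -> 0 <= x <= 1 -> 0 <= f x.
Proof.
  intros Hc H hx. apply Rnot_lt_le. intros hneg.
  pose proof (proj1 (filterlim_locally _ _) (Hc x) (mkposreal (- f x) ltac:(lra))) as [d Hd].
  assert (hd := cond_pos d).
  (* A step of at most 1/4 towards the middle stays inside the open interval and within [d] of
     [x]. *)
  assert (E : exists y, 0 < y < 1 /\ Rabs (y - x) < d).
  { destruct (Rle_lt_dec x (/ 2)) as [h | h].
    - exists (x + Rmin (d / 2) (/ 4)). assert (h1 := Rmin_l (d / 2) (/ 4)).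
      assert (h2 := Rmin_r (d / 2) (/ 4)).
      assert (0 < Rmin (d / 2) (/ 4)) by (apply Rmin_pos; lra).
      split; [lra |]. rewrite Rabs_right; lra.
    - exists (x - Rmin (d / 2) (/ 4)). assert (h1 := Rmin_l (d / 2) (/ 4)).
      assert (h2 := Rmin_r (d / 2) (/ 4)).
      assert (0 < Rmin (d / 2) (/ 4)) by (apply Rmin_pos; lra).
      split; [lra |]. rewrite Rabs_left; lra. }
  destruct E as [y [hy hyx]]. specialize (Hd y hyx). specialize (H y hy).
  change (Rabs (f y - f x) < - f x) in Hd. apply Rabs_def2 in Hd. lra.
Qed.

(** The sign of the derivative of the energy is obtained in the open rectangle [W], while the claim
    includes the boundary. The function [e], built from retracted coefficients, agrees with the
    energy on the closed rectangle and is continuous, so the inequality reaches the boundary: in [t]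
    by a mean value theorem that needs only continuity at the ends, in [s] by [limit_nonneg]. *)
Lemma flow_energy chi J Phi t1 t2 : is_interval J ->
  (forall i, smooth1 (fun x => 0 < x) (chi i)) ->
  (forall i, concave_on (fun x => 0 < x) (chi i)) ->
  flow_family chi J Phi -> J t1 -> J t2 -> t1 < t2 ->
  exists e : R -> R -> R,
    (forall t s, t1 <= t <= t2 -> 0 <= s <= 1 -> speed2 (Phi t) s = e t s)
    /\ (forall t s, continuous (e t) s)
    /\ (forall s, 0 <= s <= 1 -> e t2 s <= e t1 s).
Proof.
  intros HJ Hchi Hcc [[HM HS] Hfl] h1 h2 h12.
  assert (HJ' : forall t, t1 <= t <= t2 -> J t) by (intros t ht; exact (HJ t1 t2 t h1 h2 ht)).
  set (uh := fun i q => cf3 Phi i (retract t1 t2 q)).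
  set (fh := fun i q => partial 1 (cf3 Phi i) (retract t1 t2 q)).
  assert (hr : forall q, J (retract t1 t2 q 0%nat) /\ 0 <= retract t1 t2 q 1%nat <= 1).
  { intros q. split; [apply HJ' |]; apply clamp_range; lra. }
  assert (hu : forall i q, 0 < uh i q).
  { intros i q. destruct (hr q) as [hr1 hr2].
    destruct (M3_spec _ (HM _ _ (conj hr1 hr2)) i) as [_ [H _]]. apply H. }
  assert (cu : forall i q, cont_at 3 (uh i) q).
  { intros i q. apply cont_at_retract. destruct (HS i) as [O [hO [hI H]]].
    apply Sm_cont with O; auto. }
  assert (cf : forall i q, cont_at 3 (fh i) q).
  { intros i q. apply cont_at_retract. destruct (HS i) as [O [hO [hI H]]].
    apply Sm_cont with O; auto. apply Sm_partial; auto. }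
  assert (hid : forall q y, t1 <= q 0%nat <= t2 -> 0 <= q 1%nat <= 1 ->
    retract t1 t2 (upd q 2 y) = upd q 2 y).
  { intros q y hq0 hq1. unfold retract.
    change (upd q 2 y 0%nat) with (q 0%nat). change (upd q 2 y 1%nat) with (q 1%nat).
    rewrite !clamp_id by auto.
    replace (q 0%nat) with (upd q 2 y 0%nat) by reflexivity. rewrite upd_id.
    replace (q 1%nat) with (upd q 2 y 1%nat) by reflexivity. apply upd_id. }
  set (E := fun i => mG 2 (uh i) (fh i) (fh i)).
  assert (cE : forall i q, cont_at 3 (E i) q).
  { intros i q. exact (cont_at_mG 3 2 (uh i) (fh i) q ltac:(lia) (hu i) (cu i) (cf i)). }
  assert (EE : forall i q, t1 <= q 0%nat <= t2 -> 0 <= q 1%nat <= 1 ->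
    mG 2 (cf3 Phi i) (partial 1 (cf3 Phi i)) (partial 1 (cf3 Phi i)) q = E i q).
  { intros i q hq0 hq1.
    assert (H : forall F y, F (upd q 2 y) = F (retract t1 t2 (upd q 2 y)) :> R)
      by (intros F y; now rewrite hid).
    exact (mG_ext 2 _ (uh i) _ (fh i) q (H (cf3 Phi i)) (H (partial 1 (cf3 Phi i)))). }
  set (P := fun t s : R => upd (upd (fun _ => 0) 0 t) 1 s).
  assert (cs : forall i t s, continuous (fun s => E i (P t s)) s).
  { intros i t s. apply cont_at_line with 3%nat. apply cE. }
  assert (ct : forall i t s, continuity_pt (fun t => E i (P t s)) t).
  { intros i t s. apply continuity_pt_filterlim.
    apply (continuous_ext (fun t => E i (upd (upd (fun _ => 0) 1 s) 0 t))).
    - intros t'. unfold P. now rewrite upd_comm by auto.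
    - apply cont_at_line with 3%nat. apply cE. }
  set (W := fun t s => t1 < t < t2 /\ 0 < s < 1).
  assert (HW : open2 W).
  { unfold open2, W.
    apply (open_and (fun q : R * R => t1 < fst q < t2) (fun q : R * R => 0 < snd q < 1)).
    - apply (open_comp (fun q : R * R => fst q) (fun t => t1 < t < t2)).
      + intros q _. apply continuous_fst.
      + apply open_and; [apply open_gt | apply open_lt].
    - apply (open_comp (fun q : R * R => snd q) (fun s => 0 < s < 1)).
      + intros q _. apply continuous_snd.
      + apply open_and; [apply open_gt | apply open_lt]. }
  assert (HWD : forall t s, W t s -> J t /\ 0 <= s <= 1).
  { intros t s [ht hs]. split; [apply HJ' |]; lra. }
  assert (HP : family_in_M3 W Phi).
  { split.
    - intros t s h. apply HM, HWD, h.
    - intros i. destruct (HS i) as [O [hO [hI H]]]. exists O. repeat split; auto. }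
  assert (hk : (2 < 3)%nat) by lia. assert (hi : (0 < 3)%nat) by lia. assert (hj : (1 < 3)%nat) by lia.
  assert (hik : 0%nat <> 2%nat) by auto. assert (hjk : 1%nat <> 2%nat) by auto.
  assert (hij : 0%nat <> 1%nat) by auto.
  assert (hO := dom3_open W HW). assert (hc := dom3_upd W).
  assert (Hint : forall i s, 0 < s < 1 -> E i (P t2 s) <= E i (P t1 s)).
  { intros i s hs. assert (Hd := density_cf3 W Phi i HP). pose proof Hd as [Hu [hu' _]].
    assert (Hv := variation_partial 3 2 (dom3 W) hk hO hc _ 1 hj hjk Hd).
    destruct (variation_vel 3 2 (dom3 W) hk hO hc _ _ Hd Hv) as [z Z].
    set (G := mG 2 (cf3 Phi i) (partial 1 (cf3 Phi i)) (partial 1 (cf3 Phi i))).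
    assert (HG : SP 3 2 (dom3 W) G) by exact (variation_mG 3 2 (dom3 W) hk hO hc _ _ _ Hd Hv Hv).
    apply (nonincreasing_of_derive (fun t => E i (P t s)) (fun t => partial 0 G (P t s)));
      [lra | | auto].
    intros t ht. assert (hp : dom3 W (P t s)) by (split; assumption). split.
    - apply (is_derive_ext_loc (fun t => G (P t s))).
      + assert (L : locally t (fun t => t1 < t < t2)).
        { apply (open_and (fun t => t1 < t) (fun t => t < t2)); [apply open_gt | apply open_lt | auto]. }
        apply filter_imp with (2 := L). intros t' ht'. 
        apply EE; [change (t1 <= t' <= t2) | change (0 <= s <= 1)]; lra.
      + pose proof (SP_is_derive 3 2 (dom3 W) G 0 (P t s) HG hi hp) as D.
        revert D. apply is_derive_ext. intros t'. unfold P.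
        now rewrite upd_comm, upd_upd, upd_comm by auto.
    - apply (energy_flow_nonpos 3 2 (dom3 W) hk hO hc _ Hu hu' (chi i) 0 1 z); auto.
      + intros x hx. now apply concave_derive2_nonpos.
      + intros q hq. exact (Hfl (q 0%nat) (q 1%nat) i (q 2%nat) (proj1 (HWD _ _ hq)) (proj2 (HWD _ _ hq))). }
  exists (fun t s => sum3 (fun i => E i (P t s))). split; [| split].
  - intros t s ht hs.
    transitivity (sum3 (fun i => mG 2 (cf3 Phi i) (cf3 (d2 Phi) i) (cf3 (d2 Phi) i) (P t s)));
      [reflexivity |].
    apply sum3_ext. intros i. rewrite cf3_d2. now apply EE.
  - intros t s. unfold sum3.
    apply (continuous_plus (fun s => E i1 (P t s) + E i2 (P t s)) (fun s => E i3 (P t s))); auto.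
    apply (continuous_plus (fun s => E i1 (P t s)) (fun s => E i2 (P t s))); auto.
  - intros s hs.
    assert (Hcl : forall i, E i (P t2 s) <= E i (P t1 s)).
    { intros i. apply Rminus_le_0.
      apply (limit_nonneg (fun s => E i (P t1 s) - E i (P t2 s))); auto.
      - intros s'. apply (continuous_minus (fun s => E i (P t1 s)) (fun s => E i (P t2 s))); auto.
      - intros s' hs'. specialize (Hint i s' hs'). lra. }
    assert (k1 := Hcl i1). assert (k2 := Hcl i2). assert (k3 := Hcl i3). unfold sum3. lra.
Qed.

Lemma flow_contracts chi J Phi t1 t2 : is_interval J ->
  (forall i, smooth1 (fun x => 0 < x) (chi i)) ->
  (forall i, concave_on (fun x => 0 < x) (chi i)) ->
  flow_family chi J Phi -> J t1 -> J t2 -> t1 <= t2 ->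
  (forall s, 0 <= s <= 1 -> speed2 (Phi t2) s <= speed2 (Phi t1) s)
  /\ curve_length (Phi t2) <= curve_length (Phi t1).
Proof.
  intros HJ Hchi Hcc Hfl h1 h2 [h12 | ->]; [| split; intros; apply Rle_refl].
  destruct (flow_energy chi J Phi t1 t2 HJ Hchi Hcc Hfl h1 h2 h12) as [e [He [Hc Hle]]].
  assert (hI1 : t1 <= t1 <= t2) by lra. assert (hI2 : t1 <= t2 <= t2) by lra.
  split.
  - intros s hs. rewrite !He by auto. auto.
  - unfold curve_length.
    (* Replacing the squared speed by the everywhere continuous [e] makes both lengths integrals of
       continuous functions. *)
    assert (X : forall t, t1 <= t <= t2 -> RInt (fun s => sqrt (speed2 (Phi t) s)) 0 1
                                          = RInt (fun s => sqrt (e t s)) 0 1).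
    { intros t ht. apply RInt_ext. intros s hs. rewrite Rmin_left, Rmax_right in hs by lra.
      rewrite He by lra. reflexivity. }
    rewrite !X by auto.
    assert (Y : forall t, ex_RInt (fun s => sqrt (e t s)) 0 1).
    { intros t. apply ex_RInt_Rcont. intros s. apply (continuous_comp (e t) sqrt); auto.
      apply continuous_sqrt. }
    apply RInt_le; auto; [lra |]. intros s hs. apply sqrt_le_1_alt, Hle. lra.
Qed.

(** * Sign of the second variation of the volume *)

Lemma continuous_K u f x : smooth_S1 u -> (forall y, 0 < u y) -> smooth_S1 f ->
  continuous (K u f) x.
Proof.
  intros Su hu Sf.
  assert (cQ : continuous (Q u f) x).
  { apply (continuous_minus (fun y => RInt f 0 y) (fun _ => _)); [| apply continuous_const].
    apply (ex_derive_continuous (fun y => RInt f 0 y)). exists (f x).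
    apply (is_derive_RInt f _ 0); [| now apply smooth_S1_continuous].
    apply filter_forall. intros z. apply (RInt_correct f). apply ex_RInt_Rcont. intros y.
    now apply smooth_S1_continuous. }
  apply (continuous_minus f (fun y => Derive u y * Q u f y / u y)); [now apply smooth_S1_continuous |].
  apply (continuous_mult (fun y => Derive u y * Q u f y) (fun y => / u y)).
  - apply (continuous_mult (Derive u) (Q u f)); auto.
    apply (ex_derive_continuous (Derive u)). exact (proj2 Su 2%nat x Logic.I).
  - apply continuous_Rinv_comp; [now apply smooth_S1_continuous | apply Rgt_not_eq, hu].
Qed.

Lemma Vol_derive2_nonpos chi I Phi t i : open I -> smooth1 (fun x => 0 < x) (chi i) ->
  concave_on (fun x => 0 < x) (chi i) -> curve_in_M3 I Phi -> I t ->
  RInt (fun x => Derive_n (chi i) 2 (coef (Phi t) i x)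
                 * (K (coef (Phi t) i) (coef (dcurve Phi t) i) x) ^ 2) 0 1 <= 0.
Proof.
  intros HI Hchi Hcc HP ht.
  destruct (M3_spec _ (proj1 HP t ht) i) as [Su [hu _]].
  assert (Sf := field_smooth_S1 I _ i t (field_along_dcurve I Phi HI HP) ht).
  replace 0 with (RInt (fun _ : R => 0) 0 1) at 2
    by (rewrite RInt_const; unfold scal; simpl; unfold mult; simpl; ring).
  apply RInt_le; [lra | | apply ex_RInt_const |].
  - apply ex_RInt_Rcont. intros x.
    apply (continuous_mult (fun x => Derive_n (chi i) 2 (coef (Phi t) i x))
             (fun x => K (coef (Phi t) i) (coef (dcurve Phi t) i) x ^ 2)).
    + apply (continuous_comp (coef (Phi t) i) (Derive_n (chi i) 2)); [now apply smooth_S1_continuous |].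
      apply (ex_derive_continuous (Derive_n (chi i) 2)). exact (Hchi 3%nat _ (hu x)).
    + apply (continuous_comp (K (coef (Phi t) i) (coef (dcurve Phi t) i)) (fun y => y ^ 2)).
      * now apply continuous_K.
      * apply (ex_derive_continuous (fun y => y ^ 2)). auto_derive. auto.
  - intros x _.
    assert (h := concave_derive2_nonpos (chi i) (coef (Phi t) i x) Hchi Hcc (hu x)).
    assert (h' := pow2_ge_0 (K (coef (Phi t) i) (coef (dcurve Phi t) i) x)). nra.
Qed.

Theorem theorem6p2 (chi : idx -> R -> R)
  (chi_smooth : forall i, smooth1 (fun x => 0 < x) (chi i))
  (chi_nonneg : forall i x, 0 < x -> 0 <= chi i x)
  (chi_concave : forall i, concave_on (fun x => 0 < x) (chi i)) :
  is_Levi_Civita covD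
  /\ (forall (I : R -> Prop) (Phi : curve), open I -> is_interval I -> is_geodesic I Phi ->
        concave_on I (fun t => Vol chi (Phi t))
        /\ forall t, I t ->
             ex_derive (fun tau => Vol chi (Phi tau)) t
             /\ is_derive (Derive (fun tau => Vol chi (Phi tau))) t
                  (sum3 (fun i =>
                     RInt (fun x => Derive_n (chi i) 2 (coef (Phi t) i x)
                                    * (K (coef (Phi t) i) (coef (dcurve Phi t) i) x) ^ 2)
                       0 1)))
  /\ (forall (J : R -> Prop) (Phi : family2), is_interval J -> flow_family chi J Phi ->
        forall t1 t2, J t1 -> J t2 -> t1 <= t2 ->
          (forall s, 0 <= s <= 1 -> speed2 (Phi t2) s <= speed2 (Phi t1) s)
          /\ curve_length (Phi t2) <= curve_length (Phi t1))
  /\ (forall (phi X Y : triple) (kappa : R),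
        M3 phi -> T3 X -> T3 Y -> independent X Y ->
        is_sectional_curvature covD phi X Y kappa -> 0 <= kappa).
Proof.
  split; [exact covD_Levi_Civita |]. split; [| split].
  - intros I Phi HI HI' Hgeo.
    assert (D1 : forall t, I t -> ex_derive (fun tau => Vol chi (Phi tau)) t).
    { intros t ht. eexists. exact (Vol_derive chi I Phi t HI chi_smooth (proj1 Hgeo) ht). }
    split; [| intros t ht; split; [auto | now apply Vol_derive2 with I]].
    apply concave_of_derive2 with (2 := fun t ht => Derive_correct _ _ (D1 t ht))
      (3 := fun t ht => Vol_derive2 chi I Phi t HI chi_smooth Hgeo ht); auto.
    intros t ht.
    assert (N := fun i => Vol_derive2_nonpos chi I Phi t i HI (chi_smooth i) (chi_concave i)
                            (proj1 Hgeo) ht).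
    assert (n1 := N i1). assert (n2 := N i2). assert (n3 := N i3). unfold sum3. lra.
  - intros J Phi HJ Hfl t1 t2 h1 h2 h12. now apply flow_contracts with chi J.
  - intros phi X Y kappa _ _ _ _. apply sectional_curvature_nonneg.
Qed.
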